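(* Let $n\ge 1$ be an integer and let $\mathcal{S}_n=\{A\in\mathbb{C}^{n\times n}: A^T=A\}$ be the real vector space of complex symmetric $n\times n$ matrices, of real dimension $n^2+n$. For $A\in\mathcal{S}_n$ let $\sigma_1(A)\ge\dots\ge\sigma_n(A)\ge 0$ be its singular values. (a) If $n\ge 2$, the set $\{A\in\mathcal{S}_n:\ \sigma_j(A)=\sigma_{j+1}(A)\text{ for some }1\le j\le n-1\}$ of complex symmetric matrices having two equal singular values has real codimension $2$ in $\mathcal{S}_n$, i.e. it has real dimension $n^2+n-2$. (b) The set $\{A\in\mathcal{S}_n:\ \sigma_n(A)=0\}$ of complex symmetric matrices having a zero singular value has real codimension $2$ in $\mathcal{S}_n$, i.e. it has real dimension $n^2+n-2$.
   Context: Here $A^T$ is the transpose (without conjugation). The sets in question are semialgebraic subsets of the real vector space $\mathcal{S}_n\cong\mathbb{R}^{n^2+n}$. The dimension of such a set is the maximum of the dimensions of the strata (smooth manifolds) in a finite stratification of it, and its codimension is $n^2+n$ minus its dimension. *)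

(* Defs.v *)
From HB Require Import structures.
From mathcomp Require Import all_boot all_order all_algebra.
From mathcomp Require Import complex.
From mathcomp Require Import all_classical all_reals all_analysis.

Set Implicit Arguments.
Unset Strict Implicit.
Unset Printing Implicit Defensive.

Import Order.TTheory GRing.Theory Num.Theory.
Import numFieldNormedType.Exports.

Local Open Scope classical_set_scope.
Local Open Scope complex_scope.
Local Open Scope sesquilinear_scope.
Local Open Scope ring_scope.

(* In finite dimension, f is C^(k+1) on the open set U iff it is differentiable
   on U and all its directional derivatives are C^k on U. *)
Fixpoint C_k {R : realType} {V W : normedModType R} (k : nat)
    (U : set V) (f : V -> W) : Prop :=
  match k with
  | 0%N => forall x, U x -> {for x, continuous f}
  | k'.+1 => (forall x, U x -> differentiable f x) /\
             (forall v, C_k k' U (fun x => 'D_v f x))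
  end.

Definition smooth_on {R : realType} {V W : normedModType R}
    (U : set V) (f : V -> W) : Prop := forall k, C_k k U f.

(* M is an embedded C^oo submanifold of dimension d of the (p * q)-dimensional
   real vector space of p x q matrices: around each of its points, it is the
   zero set of a smooth map F to R^c, c = p * q - d, with surjective
   differential at that point.  The empty set is a submanifold of every
   dimension d <= p * q. *)
Definition is_submanifold {R : realType} {p q : nat} (d : nat)
    (M : set 'M[R]_(p, q)) : Prop :=
  exists2 c : nat, (d + c = p * q)%N &
    forall x, M x -> exists (U : set 'M[R]_(p, q)) (F : 'M[R]_(p, q) -> 'rV[R]_c),
      [/\ open U, U x, smooth_on U F,
          (forall w : 'rV[R]_c, exists v : 'M[R]_(p, q), 'd F x v = w) &
          M `&` U = [set y | U y /\ F y = 0]].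

(* The last clause is the frontier condition. *)
Definition is_stratification {R : realType} {p q k : nat}
    (S : set 'M[R]_(p, q)) (M : 'I_k -> set 'M[R]_(p, q)) (d : 'I_k -> nat)
    : Prop :=
  [/\ (forall i, M i !=set0),
      (forall i, is_submanifold (d i) (M i)),
      trivIset setT M,
      \bigcup_i M i = S &
      forall i j, M i `&` closure (M j) !=set0 -> M i `<=` closure (M j)].

(* Dimension is a relation; the maximum does not depend on the stratification,
   and the empty set has no dimension. *)
Definition has_dim {R : realType} {p q : nat} (S : set 'M[R]_(p, q)) (m : nat)
    : Prop :=
  exists (k : nat) (M : 'I_k -> set 'M[R]_(p, q)) (d : 'I_k -> nat),
    [/\ is_stratification S M d,
        (forall i, (d i <= m)%N) & (exists i, d i = m)].

Definition symmetric_mxs (R : realType) (n : nat) : set 'M[R[i]]_n :=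
  [set A | A^T = A].

(* The real-linear coordinates A |-> (Re A | Im A) on complex n x n matrices. *)
Definition realify {R : realType} {n : nat} (A : 'M[R[i]]_n) : 'M[R]_(n, n + n) :=
  row_mx (map_mx (@complex.Re R) A) (map_mx (@complex.Im R) A).

Definition has_real_dim {R : realType} {n : nat} (S : set 'M[R[i]]_n) (m : nat)
    : Prop :=
  has_dim (realify @` S) m.

(* Codimension inside the (n ^ 2 + n)-dimensional real space of complex
   symmetric matrices, not inside the space of all complex matrices. *)
Definition has_real_codim_sym {R : realType} {n : nat} (S : set 'M[R[i]]_n)
    (c : nat) : Prop :=
  S `<=` @symmetric_mxs R n /\
  exists2 m : nat, has_real_dim S m & (m + c = n ^ 2 + n)%N.

(* Square roots of the eigenvalues of A^* A, with multiplicity, in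
   nonincreasing order. *)
Definition singular_values {R : realType} {n : nat} (A : 'M[R[i]]_n) : seq R :=
  sort >=%R
    [seq Num.sqrt (complex.Re (spectral_diag (A ^t* *m A) 0 j)) | j <- enum 'I_n].

(* Indices start at 1: sigma A 1 >= ... >= sigma A n. *)
Definition sigma {R : realType} {n : nat} (A : 'M[R[i]]_n) (j : nat) : R :=
  nth 0 (singular_values A) j.-1.

Definition equal_singular_values (R : realType) (n : nat) : set 'M[R[i]]_n :=
  [set A | symmetric_mxs A /\
           exists2 j : nat, (1 <= j <= n - 1)%N & sigma A j = sigma A j.+1].

Definition zero_singular_value (R : realType) (n : nat) : set 'M[R[i]]_n :=
  [set A | symmetric_mxs A /\ sigma A n = 0].

(* Main.v *)
(** Complex symmetric matrices are stratified by the pattern of coincidences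
    s_i = s_{i+1} between their ordered singular values (with s_n = 0 past the
    end); both sets of the theorem are unions of strata.  The strata satisfy the
    frontier condition because such coincidences are closed conditions, while
    by the Takagi factorization A = U diag(s) U^T the singular values can be
    perturbed so as to split any prescribed coincidences.

    Near A, reduced to diag(s) by a unitary congruence, the stratum with k
    distinct positive singular values is cut out by Y^T = Y and the vanishing
    of K(Y) = Y q_Y(conj(Y) Y), for the polynomial q_Y of degree k, with
    coefficients polynomial in Y, such that Re K(Y) vanishes at one diagonal
    entry per block of equal positive singular values.  As
    K conj(Y) = Y conj(K), the entries of K(Y) outside the diagonal blocks, and
    the imaginary parts inside the blocks with s > 0, vanish as soon as the
    other ones do, and dropping these redundant equations leaves equations with
    independent differentials.  Their number depends only on the pattern and,
    among patterns with a coincidence, is smallest for a single one. *)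

Require Import Defs.
From mathcomp Require Import all_boot all_order all_algebra.
From mathcomp Require Import perm.
From mathcomp Require Import complex.
From mathcomp Require Import all_classical all_reals all_analysis.
From mathcomp Require Import ring lra zify.

Set Implicit Arguments.
Unset Strict Implicit.
Unset Printing Implicit Defensive.

Import Order.TTheory GRing.Theory Num.Theory Num.Def.
Import numFieldNormedType.Exports.

Local Open Scope classical_set_scope.
Local Open Scope complex_scope.
Local Open Scope sesquilinear_scope.
Local Open Scope ring_scope.

(** Ordered singular values need not be smooth where they coincide, so a stratum cannot be cut out
    by equating them directly. Odd polynomials [Y p(conj(Y) Y)] get around this: they commute with
    unitary congruences, act on each singular value as s |-> s p(s^2), and are polynomial in the
    real coordinates of [Y]. Multiplying the interpolating polynomial by a determinant clears its
    denominators, so all local equations are polynomial and their smoothness follows by induction on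
    polynomials. Independence of the differentials is tested at diag(s), in directions that leave
    the coefficients of [q_Y] stationary. If c is the singular value of the block concerned, the
    differential scales such a direction by q(c^2) + 2 c^2 q'(c^2), which is nonzero because c^2 is
    a simple root of q when c > 0, and q(0) is nonzero when c = 0. Conversely, the equations give
    back the exact pattern because near A coincidences can only disappear, while a polynomial of
    degree k leaves room for at most k distinct positive singular values. The ambient space consists
    of all complex matrices, of real dimension 2 n^2, so the equations [Y^T = Y] enter the count
    too. *)

Local Notation cj := (map_mx conjC).

(** * Takagi factorization *)

Section UnitaryCongruence.
Variable C : numClosedFieldType.

Lemma conjmxK m n (A : 'M[C]_(m, n)) : cj (cj A) = A.
Proof. by apply/matrixP=> i j; rewrite !mxE conjCK. Qed.

Lemma unitarymxTC n (P : 'M[C]_n) : P \is unitarymx -> P^t* *m P = 1%:M.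
Proof. by move=> Pu; rewrite -(invmx_unitary Pu) mulVmx// unitarymx_unit. Qed.

Lemma unitarymxTCj n (P : 'M[C]_n) : P \is unitarymx -> P^T *m cj P = 1%:M.
Proof.
move=> Pu; have /(congr1 (map_mx conjC)) := unitarymxTC Pu.
by rewrite map_mxM/= conjmxK map_mx1.
Qed.

Lemma unitarymxCTj n (P : 'M[C]_n) : P \is unitarymx -> cj P *m P^T = 1%:M.
Proof.
move=> /unitarymxP /(congr1 (map_mx conjC)).
by rewrite map_mxM/= conjmxK map_mx1.
Qed.

Lemma unitarymxM n (P Q : 'M[C]_n) :
  P \is unitarymx -> Q \is unitarymx -> P *m Q \is unitarymx.
Proof. exact: mul_unitarymx. Qed.

Lemma unitarymxJ n (P : 'M[C]_n) : P \is unitarymx -> cj P \is unitarymx.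
Proof. by rewrite conjC_unitary. Qed.

Lemma unitarymx1 n : (1%:M : 'M[C]_n) \is unitarymx.
Proof. by apply/unitarymxP; rewrite trmx1 map_mx1 mulmx1. Qed.

Lemma char_poly_invmx_conj n (P A : 'M[C]_n) : P \in unitmx ->
  char_poly (invmx P *m A *m P) = char_poly A.
Proof.
move=> Pu; rewrite /char_poly.
have -> : char_poly_mx (invmx P *m A *m P) =
    map_mx polyC (invmx P) *m char_poly_mx A *m map_mx polyC P.
  rewrite /char_poly_mx mulmxBr mulmxBl !map_mxM/=; congr (_ - _).
  rewrite scalar_mxC -mulmxA -map_mxM/= mulVmx// map_mx1 mulmx1//.
rewrite !det_mulmx mulrAC -det_mulmx -map_mxM mulVmx// map_mx1 det1 mul1r//.
Qed.

Lemma char_poly_diag n (d : 'rV[C]_n) :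
  char_poly (diag_mx d) = \prod_i ('X - (d 0 i)%:P).
Proof.
rewrite char_poly_trig ?diag_mx_is_trig//.
by apply: eq_bigr => i _; rewrite mxE eqxx mulr1n.
Qed.

(** Both diagonalizations give the same characteristic polynomial, whose linear factors are unique
    up to order. *)
Lemma spectral_diag_perm n (P A : 'M[C]_n) (d : 'rV[C]_n) : A \is normalmx ->
  P \in unitmx -> A = invmx P *m diag_mx d *m P ->
  perm_eq [seq spectral_diag A 0 j | j <- enum 'I_n] [seq d 0 j | j <- enum 'I_n].
Proof.
move=> /orthomx_spectralP AE Pu dE; apply: prod_XsubC_eq.
rewrite big_map big_enum/= big_map big_enum/=.
have := char_poly_diag d; rewrite -(char_poly_invmx_conj _ Pu) -dE {1}AE.
by rewrite char_poly_invmx_conj ?spectral_unit// char_poly_diag.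
Qed.

Lemma gram_hermitian n (A : 'M[C]_n) : A^t* *m A \is hermsymmx.
Proof.
apply/is_hermitianmxP; rewrite expr0 scale1r trmx_mul map_mxM/=.
by rewrite trmxCK.
Qed.

Lemma dotmx_row_gram n (u : 'rV[C]_n) : (u *m u^t*) 0 0 = \sum_i `|u 0 i| ^+ 2.
Proof. by rewrite mxE; apply: eq_bigr => i _; rewrite !mxE normCK. Qed.

Lemma dotmx_row_ge0 n (u : 'rV[C]_n) : 0 <= (u *m u^t*) 0 0.
Proof. by rewrite dotmx_row_gram sumr_ge0// => i _; rewrite exprn_ge0. Qed.

Lemma dotmx_row_gt0 n (u : 'rV[C]_n) : u != 0 -> 0 < (u *m u^t*) 0 0.
Proof. by move=> u0; rewrite -dotmxE dotmx_is_dotmx. Qed.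

(* If [v] is an eigenvector of [A conj(A)] for s^2, then conj(v A) + s v is
   the required vector, unless it vanishes, in which case ['i v] is. *)
Lemma coneigenvector n (A : 'M[C]_n) : (0 < n)%N -> A^T = A ->
  exists2 x : 'rV[C]_n, x != 0 & exists2 s : C, 0 <= s & x *m A = s *: cj x.
Proof.
move=> n0 symA; have [l /eigenvalueP[v vl v0]] := eigenvalue_closed (A *m cj A) n0.
have l0 : 0 <= l.
  have := dotmx_row_ge0 (v *m A); rewrite trmx_mul map_mxM/= symA mulmxA.
  rewrite -(mulmxA v) vl -scalemxAl mxE.
  by rewrite pmulr_lge0// dotmx_row_gt0.
have s0 : 0 <= sqrtC l by rewrite sqrtC_ge0.
have sE : (sqrtC l)^* = sqrtC l by apply/CrealP; exact: ger0_real.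
pose x := cj (v *m A) + sqrtC l *: v.
have [x0|x0] := eqVneq x 0; last first.
  exists x => //; exists (sqrtC l) => //; rewrite /x mulmxDl.
  rewrite -scalemxAl map_mxD conjmxK map_mxZ/= sE scalerDr scalerA -expr2 sqrtCK.
  rewrite addrC; congr (_ + _).
  by apply: (can_inj (@conjmxK _ _)); rewrite map_mxM/= conjmxK -mulmxA vl map_mxZ/=
    conjmxK (CrealP (ger0_real l0)).
exists ('i *: v); first by rewrite scaler_eq0 negb_or neq0Ci.
exists (sqrtC l) => //; rewrite map_mxZ/= conjCi scalerA mulrN scaleNr mulrC -scalerA.
have /(congr1 (map_mx conjC)) : cj (v *m A) = - (sqrtC l *: v).
  by apply/eqP; rewrite -addr_eq0 -/x x0.
rewrite conjmxK map_mxN/= map_mxZ/= sE -scalemxAl => ->.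
by rewrite scalerN.
Qed.

(** Deflation: if the first row of a unitary [S] is a coneigenvector, the first row of [S A S^T] is
    [s e_0]; by symmetry so is the first column, and a smaller symmetric block remains. *)
Theorem takagi n (A : 'M[C]_n) : A^T = A ->
  exists2 P : 'M[C]_n, P \is unitarymx &
  exists2 d : 'rV[C]_n, (forall i, 0 <= d 0 i) & P *m A *m P^T = diag_mx d.
Proof.
elim: n A => [|n IH] A symA.
  exists 1%:M; first by apply/unitarymxP; rewrite trmx1 map_mx1 mulmx1.
  by exists 0 => [[]//|]; apply/matrixP => -[].
have [//|x x0 [s s0 xs]] := coneigenvector _ symA.
(* All rows are equal to [x]: orthonormalization yields a unitary matrix even from dependent rows,
   and its first row spans the line of [x]. *)
pose S := schmidt (\matrix_(i < n.+1, j < n.+1) x 0 j).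
have Su : S \is unitarymx by exact: schmidt_unitarymx.
have rowx : row 0 (\matrix_(i < n.+1, j < n.+1) x 0 j) = x.
  by apply/rowP => j; rewrite !mxE.
have := row_schmidt_sub (\matrix_(i < n.+1, j < n.+1) x 0 j) 0.
rewrite (big_pred1 0); last by move=> k; rewrite /= leqn0.
rewrite genmxE -/S rowx => /sub_rVP[c xc].
have c0 : 0 <= c.
  have := form1_row_schmidt (\matrix_(i < n.+1, j < n.+1) x 0 j) 0.
  rewrite rowx -/S xc linearZl_LR/= (row_unitarymxP Su 0 0) eqxx/=.
  by rewrite mulr1.
have cn0 : c != 0 by apply: contraNneq x0 => c0'; rewrite xc c0' scale0r.
have ys : row 0 S *m A = s *: cj (row 0 S).
  apply: (scalerI cn0); rewrite scalemxAl -xc xs xc map_mxZ/=.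
  by rewrite (CrealP (ger0_real c0)) !scalerA mulrC.
have [B defB] : exists B : 'M[C]_(1 + n), B = S *m A *m S^T by exists (S *m A *m S^T).
have symB : B^T = B by rewrite defB !trmx_mul trmxK symA mulmxA.
have rowB j : B 0 j = s * (0 == j)%:R.
  have -> : B 0 j = (row 0 B) 0 j by rewrite mxE.
  have -> : row 0 B = s *: row 0 1%:M.
    rewrite defB !row_mul ys -scalemxAl; congr (_ *: _).
    rewrite -(unitarymxCTj Su) row_mul; congr (_ *m _).
    by apply/rowP => k; rewrite !mxE.
  by rewrite !mxE.
have B00 : ulsubmx B = s%:M.
  apply/matrixP => i j; rewrite !ord1 !mxE/=.
  rewrite (_ : lshift n 0 = 0); last exact: val_inj.
  by rewrite rowB mulr_natr.
have B01 : ursubmx B = 0.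
  apply/matrixP => i j; rewrite !ord1 !mxE/=.
  rewrite (_ : lshift n 0 = 0); last exact: val_inj.
  by rewrite rowB mulr0.
have B10 : dlsubmx B = 0 by rewrite -symB -trmx_ursub B01 trmx0.
have BE : B = block_mx s%:M 0 0 (drsubmx B) by rewrite -[LHS]submxK B00 B01 B10.
have [|P Pu [d d0 Pd]] := IH (drsubmx B).
  by rewrite trmx_drsub symB.
pose Q : 'M[C]_(1 + n) := block_mx 1%:M 0 0 P.
have Qu : Q *m Q^t* = 1%:M.
  rewrite tr_block_mx map_block_mx mulmx_block !trmx0 !trmx1 !map_mx0 !map_mx1.
  rewrite !mulmx0 !mul0mx !mul1mx !addr0 !add0r (unitarymxP Pu).
  by rewrite -scalar_mx_block.
exists (Q *m S); first by apply: mul_unitarymx => //; apply/unitarymxP.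
exists (row_mx s%:M d : 'rV[C]_(1 + n)).
  by move=> i; rewrite mxE; case: fintype.split => j //; rewrite !ord1 mxE.
have -> : Q *m S *m A *m (Q *m S)^T = Q *m B *m Q^T.
  by rewrite defB trmx_mul !mulmxA.
rewrite BE /Q tr_block_mx !mulmx_block !trmx0 !trmx1.
rewrite !mulmx0 !mul0mx !mul1mx !mulmx1 !addr0 !add0r Pd.
apply: (etrans _ (esym (@diag_mx_row _ n 1 s%:M d))).
rewrite mul0mx (_ : diag_mx (s%:M : 'M[C]_1) = s%:M)//.
by apply/matrixP => i j; rewrite !mxE !ord1 !eqxx.
Qed.

Lemma unitary_congrK n (P A D : 'M[C]_n) : P \is unitarymx ->
  P *m A *m P^T = D -> A = P^t* *m D *m cj P.
Proof.
move=> Pu <-; rewrite !mulmxA unitarymxTC// mul1mx -mulmxA unitarymxTCj//.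
by rewrite mulmx1.
Qed.

Lemma unitary_congr_gram n (P A D : 'M[C]_n) : P \is unitarymx -> D^t* = D ->
  P *m A *m P^T = D -> A^t* *m A = invmx (cj P) *m (D *m D) *m cj P.
Proof.
move=> Pu DD PA.
have PcU : cj P \is unitarymx by rewrite conjC_unitary.
have cjPT : (cj P)^t* = P^T by rewrite -map_trmx conjmxK.
rewrite invmx_unitary// cjPT (unitary_congrK Pu PA).
have -> : (P^t* *m D *m cj P)^t* = P^T *m (D *m P).
  by rewrite !trmx_mul !map_mxM/= trmxCK DD cjPT.
rewrite -!mulmxA; congr (_ *m (_ *m _)).
by rewrite !mulmxA (unitarymxP Pu) mul1mx.
Qed.

End UnitaryCongruence.

(** * Perturbation of eigenvalues *)

Section EigenvaluePerturbation.
Variable C : numClosedFieldType.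

(** Dimension count: l + 1 free coordinates against l linear conditions. *)
Lemma common_test_vector n (M : 'M[C]_n) (l : 'I_n) :
  exists z : 'rV[C]_n, [/\ z != 0, forall i : 'I_n, (l < i)%N -> z 0 i = 0 &
                           forall j : 'I_n, (j < l)%N -> (z *m M) 0 j = 0].
Proof.
(* The upper left block of [M]; its row count exceeds its rank. *)
pose N : 'M[C]_(l.+1, l) := pid_mx l.+1 *m M *m pid_mx l.
have : kermx N != 0.
  rewrite -mxrank_eq0 mxrank_ker subn_eq0 -ltnNge ltnS; exact: rank_leq_col.
move=> /rowV0Pn[w /sub_kermxP wN w0]; exists (w *m pid_mx l.+1); split.
- apply: contraNneq w0 => wp0.
  have : w *m pid_mx l.+1 *m (pid_mx l.+1 : 'M[C]_(n, l.+1)) = w.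
    by rewrite -mulmxA mul_pid_mx minnn (minn_idPr (ltn_ord l)) pid_mx_1 mulmx1.
  by rewrite wp0 mul0mx => <-.
- move=> i li; rewrite mxE big1// => k _; rewrite mxE.
  case: eqP => [ki|_]; last by rewrite mulr0.
  by rewrite -ki ltnNge -ltnS ltn_ord in li.
- move=> j jl; have /rowP/(_ (Ordinal jl)) := wN.
  rewrite /N !mulmxA [RHS]mxE => <-; rewrite [RHS]mxE (bigD1 j)//= big1 ?addr0.
    by rewrite [X in _ * X]mxE eqxx jl mulr1.
  move=> k kj; rewrite [pid_mx _ _ _]mxE.
  by rewrite (_ : _ == _ :> nat = false) ?mulr0//; apply/negbTE; rewrite (inj_eq val_inj).
Qed.

Lemma diag_form n (a : 'rV[C]_n) (z : 'rV[C]_n) :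
  (z *m diag_mx a *m z^t*) 0 0 = \sum_i a 0 i * `|z 0 i| ^+ 2.
Proof.
rewrite mxE; apply: eq_bigr => i _.
by rewrite mul_mx_diag !mxE normCK mulrAC mulrC.
Qed.

(** From |y_i| |y_j| <= (|y_i|^2 + |y_j|^2) / 2; summed over all pairs, the right-hand side is n
    times the sum of the |y_i|^2. *)
Lemma form_le n (E : 'M[C]_n) (d : C) (y : 'rV[C]_n) :
  (forall i j, `|E i j| <= d) ->
  `|(y *m E *m y^t*) 0 0| <= n%:R * d * (y *m y^t*) 0 0.
Proof.
move=> Ed; rewrite dotmx_row_gram mxE.
apply: (@le_trans _ _ (\sum_j \sum_i d * ((`|y 0 i| ^+ 2 + `|y 0 j| ^+ 2) / 2))).
  apply: (le_trans (ler_norm_sum _ _ _)); apply: ler_sum => j _.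
  rewrite !mxE mulr_suml; apply: (le_trans (ler_norm_sum _ _ _)).
  apply: ler_sum => i _; rewrite !normrM norm_conjC mulrAC mulrC.
  apply: ler_pM; rewrite ?mulr_ge0// ?ler_pdivlMr//.
  rewrite -subr_ge0 (_ : _ - _ = (`|y 0 i| - `|y 0 j|) ^+ 2).
    by rewrite real_exprn_even_ge0// rpredB// normr_real.
  by ring.
rewrite le_eqVlt; apply/orP; left; apply/eqP.
under eq_bigr do rewrite -mulr_sumr -mulr_suml big_split/= sumr_const card_ord.
rewrite -mulr_sumr -mulr_suml big_split/= sumr_const card_ord sumrMnl.
set S := \sum_i _; by rewrite -(mulr_natl S n); field.
Qed.

(* Both quadratic forms are tested on a vector spanned by the first [l + 1]
   eigenvectors of [GA] and also by the eigenvectors of [GB] from the [l]-th on. *)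
Lemma eigenvalue_perturbation n (P Q GA GB : 'M[C]_n) (a b : 'rV[C]_n) (d : C)
    (l : 'I_n) : P \is unitarymx -> Q \is unitarymx ->
  GA = invmx P *m diag_mx a *m P -> GB = invmx Q *m diag_mx b *m Q ->
  (forall i : 'I_n, (i <= l)%N -> a 0 l <= a 0 i) ->
  (forall i : 'I_n, (l <= i)%N -> b 0 i <= b 0 l) ->
  (forall i j, `|(GA - GB) i j| <= d) ->
  (forall i, a 0 i \is Num.real) -> (forall i, b 0 i \is Num.real) ->
  a 0 l <= b 0 l + n%:R * d.
Proof.
move=> Pu Qu GAE GBE al bl Gd ar br.
have [z [z0 zl zM]] := common_test_vector (P *m Q^t*) l.
pose y := z *m P; pose u := z *m (P *m Q^t*).
have yP : y *m invmx P = z by rewrite mulmxK// unitarymx_unit.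
have yQ : y *m invmx Q = u by rewrite invmx_unitary// /y -mulmxA.
have conjP (W : 'M[C]_n) (v : 'rV[C]_n) : W \is unitarymx ->
    W *m v^t* = (v *m invmx W)^t*.
  by move=> Wu; rewrite invmx_unitary// trmx_mul map_mxM/= trmxCK.
have nE (W : 'M[C]_n) : W \is unitarymx ->
    (y *m y^t*) 0 0 = \sum_i `|(y *m invmx W) 0 i| ^+ 2.
  move=> Wu; rewrite -dotmx_row_gram -conjP// mulmxA mulmxKV//.
  exact: unitarymx_unit.
have HA : (y *m GA *m y^t*) 0 0 = \sum_i a 0 i * `|z 0 i| ^+ 2.
  by rewrite GAE !mulmxA -mulmxA conjP// yP diag_form.
have HB : (y *m GB *m y^t*) 0 0 = \sum_i b 0 i * `|u 0 i| ^+ 2.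
  by rewrite GBE !mulmxA -mulmxA conjP// yQ diag_form.
have n0 : 0 < (y *m y^t*) 0 0.
  by rewrite (nE P Pu) yP -dotmx_row_gram dotmx_row_gt0.
have leA : a 0 l * (y *m y^t*) 0 0 <= (y *m GA *m y^t*) 0 0.
  rewrite HA (nE P Pu) yP mulr_sumr; apply: ler_sum => i _.
  have [il|il] := leqP i l; first by rewrite ler_wpM2r ?exprn_ge0// al.
  by rewrite zl// normr0 expr0n/= !mulr0.
have leB : (y *m GB *m y^t*) 0 0 <= b 0 l * (y *m y^t*) 0 0.
  rewrite HB (nE Q Qu) yQ mulr_sumr; apply: ler_sum => i _.
  have [il|il] := ltnP i l; last by rewrite ler_wpM2r ?exprn_ge0// bl.
  by rewrite /u zM// normr0 expr0n/= !mulr0.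
have leAB : (y *m GA *m y^t*) 0 0 <=
    (y *m GB *m y^t*) 0 0 + n%:R * d * (y *m y^t*) 0 0.
  rewrite -lerBlDl; apply: le_trans (form_le y Gd).
  rewrite mulmxBr mulmxBl [X in `|X|]mxE [X in `|_ + X|]mxE; apply: real_ler_norm.
  by rewrite HA HB rpredB// rpred_sum// => i _; rewrite rpredM// rpredX// normr_real.
rewrite -(ler_pM2r n0) mulrDl; apply: (le_trans leA); apply: (le_trans leAB).
by rewrite lerD2r.
Qed.

End EigenvaluePerturbation.

(** * Odd powers and rigidity *)

Section OddPowers.
Variable C : numClosedFieldType.

(* The odd powers that commute with the congruences Y |-> P Y P^T, [P] unitary. *)
Definition opow n (Y : 'M[C]_n) (j : nat) : 'M[C]_n :=
  iter j (fun Z => Z *m (cj Y *m Y)) Y.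

Lemma opowS n (Y : 'M[C]_n) j : opow Y j.+1 = opow Y j *m (cj Y *m Y).
Proof. by []. Qed.

Lemma cjM m n p (A : 'M[C]_(m, n)) (B : 'M[C]_(n, p)) : cj (A *m B) = cj A *m cj B.
Proof. exact: map_mxM. Qed.

Lemma opow_congr n (P Y : 'M[C]_n) j : P \is unitarymx ->
  opow (P *m Y *m P^T) j = P *m opow Y j *m P^T.
Proof.
move=> Pu; elim: j => // j IH; rewrite !opowS IH !cjM -!mulmxA.
congr (_ *m (_ *m _)).
have cjPT : cj P^T *m P = 1%:M by rewrite unitarymxTC.
rewrite (mulmxA P^T) unitarymxTCj// mul1mx; congr (_ *m _).
by rewrite (mulmxA (cj _)) cjPT mul1mx.
Qed.

(** Both sides are the alternating product Y conj(Y) ... Y conj(Y) of 2 j + 2 factors. This is the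
    source of the relation [K conj(Y) = Y conj(K)]. *)
Lemma mul_opow_cj n (Y : 'M[C]_n) j : opow Y j *m cj Y = Y *m cj (opow Y j).
Proof.
elim: j => [|j IH]; first by [].
by rewrite opowS !cjM conjmxK !mulmxA -IH.
Qed.

Lemma mul_cj_opow n (Y : 'M[C]_n) j :
  Y *m cj Y *m opow Y j = opow Y j *m (cj Y *m Y).
Proof. by elim: j => [|j IH]; [rewrite mulmxA | rewrite opowS mulmxA IH]. Qed.

Lemma tr_opow n (Y : 'M[C]_n) j : Y^T = Y -> (opow Y j)^T = opow Y j.
Proof.
move=> YT; elim: j => // j IH.
by rewrite opowS !trmx_mul IH map_trmx YT mul_cj_opow.
Qed.

End OddPowers.

Section Rigidity.
Variable C : numClosedFieldType.

(** The bound is the inverse of 1 plus the sum of the 1 / f i; the summand 1 covers an empty [P],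
    and no minimum is taken in the partial order of [C]. *)
Lemma finite_lower_bound (I : finType) (P : pred I) (f : I -> C) :
  (forall i, P i -> 0 < f i) -> exists2 m, 0 < m & forall i, P i -> m <= f i.
Proof.
move=> f0; have S0 : 0 <= \sum_(i | P i) (f i)^-1.
  by apply: sumr_ge0 => i /f0 fi; rewrite invr_ge0 ltW.
have D0 : 0 < 1 + \sum_(i | P i) (f i)^-1 by rewrite ltr_wpDr.
exists (1 + \sum_(i | P i) (f i)^-1)^-1 => [|i Pi]; first by rewrite invr_gt0.
rewrite -[leRHS]invrK lef_pV2 ?posrE ?invr_gt0 ?f0//.
rewrite (bigD1 i)//= addrCA lerDl addr_ge0// sumr_ge0// => j /andP[/f0 fj _].
by rewrite invr_ge0 ltW.
Qed.

(* Entrywise, [K conj(Y) = Y conj(K)] at [Y = diag s] forces [K a b = 0] unless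
   [s a = s b], and [K a b] to be real if [s a = s b > 0]; the remaining
   hypotheses then kill [K], and this persists for [Y] close to [diag s]. *)
Lemma conj_commute_rigidity n (s : 'I_n -> C) : (forall i, 0 <= s i) ->
  exists2 e : C, 0 < e & forall Y K : 'M[C]_n,
    (forall i j, `|Y i j - (i == j)%:R * s i| <= e) -> K^T = K ->
    K *m cj Y = Y *m cj K ->
    (forall a b, s a = s b -> (K a b)^* = - K a b) ->
    (forall a b, s a = 0 -> s b = 0 -> K a b = 0) -> K = 0.
Proof.
move=> s0.
have f1 (ab : 'I_n * 'I_n) : s ab.1 != s ab.2 -> 0 < `|s ab.2 ^+ 2 - s ab.1 ^+ 2|.
  by case: ab => a b /= ab; rewrite normr_gt0 subr_eq0 eqrXn2// eq_sym.
have [m1 m10 m1P] := finite_lower_bound f1.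
have f2 a : s a != 0 -> 0 < s a by move=> sa; rewrite lt_def sa s0.
have [m2 m20 m2P] := finite_lower_bound f2.
pose S := 1 + \sum_i s i.
have sS i : s i <= S.
  rewrite /S (bigD1 i)//= addrCA lerDl addr_ge0// sumr_ge0//.
have S1 : 1 <= S by rewrite lerDl sumr_ge0.
have S0 : 0 < S by exact: lt_le_trans S1.
pose c := 4 * S / m1 + m2^-1.
have c0 : 0 <= c.
  by rewrite addr_ge0 ?invr_ge0 ?(ltW m20)// divr_ge0 ?(ltW m10)// mulr_ge0// ltW.
(* With this choice n^2 c e = 1 - e < 1, so the estimate T <= n^2 c e T obtained below forces T =
   0. *)
pose e := (1 + (n * n)%:R * c)^-1.
have D0 : 0 < 1 + (n * n)%:R * c by rewrite ltr_wpDr// mulr_ge0.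
have e0 : 0 < e by rewrite invr_gt0.
exists e => // Y K Ye KT KY K1 K2.
have KTs a b : K a b = K b a by rewrite -{1}KT mxE.
pose T := \sum_a \sum_b `|K a b|.
have row_le i : \sum_l `|K i l| <= T.
  by rewrite /T [leRHS](bigD1 i)//= lerDl sumr_ge0// => j _; rewrite sumr_ge0.
have KTe a b : `|K a b| <= T.
  by apply: le_trans (row_le a); rewrite [leRHS](bigD1 b)//= lerDl sumr_ge0.
have T0 : 0 <= T by rewrite sumr_ge0// => a _; rewrite sumr_ge0.
(* The entry of [K conj(D) - D conj(K)] for [D = diag s]. As [K conj(Y) = Y conj(K)], it is a sum of
   products of entries of [Y - D] and of [K], up to conjugation, hence of size O(e T). *)
pose E a b := K a b * s b - s a * (K a b)^*.
have Eb a b : `|E a b| <= 2 * e * T.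
  have -> : E a b = \sum_l (Y a l - (a == l)%:R * s a) * (K l b)^* -
      \sum_l K a l * (Y l b - (l == b)%:R * s l)^*.
    have -> : \sum_l (Y a l - (a == l)%:R * s a) * (K l b)^* =
        (Y *m cj K) a b - s a * (K a b)^*.
      rewrite mxE (eq_bigr (fun l => Y a l * (cj K) l b - (a == l)%:R * (s a * (K l b)^*))).
        rewrite sumrB; congr (_ - _); rewrite (bigD1 a)//= eqxx mul1r big1 ?addr0// => l la.
        by rewrite eq_sym (negbTE la) mul0r.
      by move=> l _; rewrite mxE mulrBl mulrA.
    have -> : \sum_l K a l * (Y l b - (l == b)%:R * s l)^* =
        (K *m cj Y) a b - K a b * s b.
      rewrite mxE (eq_bigr (fun l => K a l * (cj Y) l b - (l == b)%:R * (K a l * s l))).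
        rewrite sumrB; congr (_ - _); rewrite (bigD1 b)//= eqxx mul1r big1 ?addr0// => l lb.
        by rewrite (negbTE lb) mul0r.
      move=> l _; rewrite mxE rmorphB rmorphM/= rmorph_nat mulrBr mulrCA.
      by rewrite (CrealP (ger0_real (s0 l))).
    by rewrite KY /E; ring.
  rewrite (le_trans (ler_normB _ _))// -mulrA mulr_natl mulr2n lerD//.
    rewrite (le_trans (ler_norm_sum _ _ _))// (le_trans _ (ler_wpM2l (ltW e0) (row_le b)))//.
    rewrite mulr_sumr ler_sum// => l _; rewrite normrM norm_conjC.
    by rewrite (KTs l b) ler_wpM2r.
  rewrite (le_trans (ler_norm_sum _ _ _))// (le_trans _ (ler_wpM2l (ltW e0) (row_le a)))//.
  by rewrite mulr_sumr ler_sum// => l _; rewrite normrM norm_conjC mulrC ler_wpM2r.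
have eT0 : 0 <= e * T by rewrite mulr_ge0// ltW.
have cE : c * (e * T) = 4 * S * (e * T) / m1 + m2^-1 * (e * T) by rewrite /c; ring.
have Kb a b : `|K a b| <= c * (e * T).
  have [sab|sab] := eqVneq (s a) (s b); last first.
    have : `|K a b| * m1 <= 4 * S * (e * T).
      apply: (@le_trans _ _ (`|K a b| * `|s b ^+ 2 - s a ^+ 2|)).
        by rewrite ler_wpM2l// (m1P (a, b)).
      (* Eliminates the conjugate of [K a b] between the equations at (a, b) and (b, a), using the
         symmetry of [K]. *)
      have -> : `|K a b| * `|s b ^+ 2 - s a ^+ 2| = `|s b * E a b - s a * E b a|.
        rewrite -normrM /E (KTs b a); congr `|_|; ring.
      rewrite (le_trans (ler_normB _ _))// !normrM (ger0_norm (s0 a)) (ger0_norm (s0 b)).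
      have -> : 4 * S * (e * T) = S * (2 * e * T) + S * (2 * e * T) by ring.
      by rewrite lerD// ler_pM.
    rewrite -ler_pdivlMr// => /le_trans; apply.
    by rewrite cE lerDl mulr_ge0// invr_ge0 ltW.
  have [sa0|sa0] := eqVneq (s a) 0.
    by rewrite (K2 a b) -?sab// normr0 mulr_ge0.
  have : `|K a b| * m2 <= e * T.
    apply: (@le_trans _ _ (`|K a b| * s a)); first by rewrite ler_wpM2l// m2P.
    (* Here [K a b] is purely imaginary, so the two terms of [E a b] add up. *)
    have EE : E a b = 2 * (K a b * s a) by rewrite /E K1// -sab; ring.
    have := Eb a b; rewrite EE normrM ger0_norm// -mulrA ler_pM2l//.
    by rewrite normrM (ger0_norm (s0 a)).
  rewrite -ler_pdivlMr// mulrC => /le_trans; apply.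
  rewrite cE lerDr.
  by rewrite divr_ge0 ?(ltW m10)// mulr_ge0// mulr_ge0// ltW.
have TT : T <= (n * n)%:R * c * e * T.
  rewrite {1}/T; apply: (@le_trans _ _ (\sum_(a < n) \sum_(b < n) c * (e * T))).
    by apply: ler_sum => a _; apply: ler_sum => b _.
  by rewrite !sumr_const !card_ord -mulrnA -[leLHS]mulr_natl !mulrA lexx.
have Tz : T = 0.
  apply: le_anti; rewrite T0 andbT -(pmulr_rle0 _ e0).
  have : 0 <= - (e * T).
    have E1 : e * (1 + (n * n)%:R * c) = 1 by rewrite mulVf ?lt0r_neq0.
    have <- : (n * n)%:R * c * e * T - T = - (e * T).
      have -> : (n * n)%:R * c * e * T - T =
        (e * (1 + (n * n)%:R * c) - e) * T - T by ring.
      by rewrite E1; ring.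
    by rewrite subr_ge0.
  by rewrite oppr_ge0.
apply/matrixP => a b; rewrite mxE; apply/eqP; rewrite -normr_eq0.
by apply/eqP/le_anti; rewrite normr_ge0 andbT -Tz KTe.
Qed.
End Rigidity.
(** * Singular values of symmetric matrices *)

Section SingularValues.
Variable R : realType.
Local Notation C := R[i].
Implicit Types (n : nat).

Definition rdiag n (s : 'I_n -> R) : 'M[C]_n := diag_mx (\row_i (s i)%:C).

Lemma rdiagE n (s : 'I_n -> R) i j : rdiag s i j = if i == j then (s i)%:C else 0.
Proof. by rewrite !mxE; case: eqP => [->|]; rewrite ?mulr1n ?mulr0n. Qed.

Lemma eq_rdiag n (s s' : 'I_n -> R) : s =1 s' -> rdiag s = rdiag s'.
Proof. by move=> ss; apply/matrixP => i j; rewrite !rdiagE ss. Qed.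

Lemma conjC_real (x : R) : (x%:C)^*%R = x%:C.
Proof. exact: conjc_real. Qed.

Lemma cj_rdiag n (s : 'I_n -> R) : cj (rdiag s) = rdiag s.
Proof.
apply/matrixP => i j; rewrite mxE rdiagE; case: eqP => _; last by rewrite rmorph0.
exact: conjC_real.
Qed.

Lemma rdiagM n (s s' : 'I_n -> R) : rdiag s *m rdiag s' = rdiag (fun i => s i * s' i).
Proof.
rewrite mulmx_diag /rdiag; congr diag_mx; apply/rowP => i.
by rewrite !mxE -rmorphM.
Qed.

Lemma tr_rdiag n (s : 'I_n -> R) : (rdiag s)^T = rdiag s.
Proof. exact: tr_diag_mx. Qed.

Lemma takagi_real n (A : 'M[C]_n) : A^T = A ->
  exists2 P : 'M[C]_n, P \is unitarymx &
  exists2 s : 'I_n -> R, (forall i, 0 <= s i) & P *m A *m P^T = rdiag s.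
Proof.
move=> /takagi[P Pu [d d0 Pd]]; exists P => //.
exists (fun i => complex.Re (d 0 i)).
  by move=> i; have := d0 i; rewrite lecE => /andP[].
rewrite Pd; congr diag_mx; apply/rowP => i; rewrite mxE RRe_real//.
exact: ger0_real.
Qed.

Definition sg n (A : 'M[C]_n) (i : nat) : R := nth 0 (singular_values A) i.

Lemma congr_rdiag_gram n (P A : 'M[C]_n) (s : 'I_n -> R) : P \is unitarymx ->
  P *m A *m P^T = rdiag s ->
  A^t* *m A = invmx (cj P) *m rdiag (fun i => s i ^+ 2) *m cj P.
Proof.
move=> Pu PA; rewrite -(rdiagM s s); apply: unitary_congr_gram => //.
by rewrite tr_rdiag cj_rdiag.
Qed.

Lemma singular_values_perm n (P A : 'M[C]_n) (s : 'I_n -> R) : P \is unitarymx ->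
  (forall i, 0 <= s i) -> P *m A *m P^T = rdiag s ->
  perm_eq (singular_values A) [seq s j | j <- enum 'I_n].
Proof.
move=> Pu s0 PA; rewrite /singular_values perm_sort.
have := spectral_diag_perm (hermitian_normalmx (gram_hermitian A)) _
  (congr_rdiag_gram Pu PA).
rewrite unitarymx_unit ?conjC_unitary// => /(_ isT).
move=> /(perm_map (fun z => Num.sqrt (complex.Re z))); rewrite -!map_comp => E.
apply: (perm_trans E); rewrite (@eq_map _ _ _ s) ?perm_refl// => j.
by rewrite /= mxE/= sqrtr_sqr ger0_norm.
Qed.

Lemma size_singular_values n (A : 'M[C]_n) : size (singular_values A) = n.
Proof. by rewrite size_sort size_map size_enum_ord. Qed.

Lemma sg_default n (A : 'M[C]_n) i : (n <= i)%N -> sg A i = 0.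
Proof. by move=> ni; rewrite /sg nth_default// size_singular_values. Qed.

Lemma sg_ge0 n (A : 'M[C]_n) i : 0 <= sg A i.
Proof.
have [ni|ni] := ltnP i n; last by rewrite sg_default.
have : sg A i \in singular_values A by rewrite mem_nth// size_singular_values.
by rewrite mem_sort => /mapP[j _ ->]; exact: sqrtr_ge0.
Qed.

Lemma sg_le n (A : 'M[C]_n) i j : (i <= j)%N -> sg A j <= sg A i.
Proof.
move=> ij; have [nj|nj] := ltnP j n; last by rewrite (sg_default A nj) sg_ge0.
have so : sorted >=%R (singular_values A) by apply: sort_sorted; exact: ge_total.
apply: (sorted_leq_nth _ _ _ so) => //.
- exact: ge_trans.
- exact: ge_refl.
- by rewrite inE size_singular_values (leq_ltn_trans ij).
- by rewrite inE size_singular_values.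
Qed.

Lemma sg_unique n (P A : 'M[C]_n) (s : 'I_n -> R) : P \is unitarymx ->
  (forall i, 0 <= s i) -> (forall i j : 'I_n, (i <= j)%N -> s j <= s i) ->
  P *m A *m P^T = rdiag s -> forall i : 'I_n, sg A i = s i.
Proof.
move=> Pu s0 sle PA i; rewrite /sg.
have -> : singular_values A = [seq s j | j <- enum 'I_n] :> seq R.
  apply: (sorted_eq (@ge_trans _ _) (@ge_anti _ _)).
  - by apply: sort_sorted; exact: ge_total.
  - apply/(sortedP 0) => k; rewrite size_map size_enum_ord => kn.
    have nthE m : (m < n)%N -> [seq s j | j <- enum 'I_n]`_m =
        s (nth (Ordinal kn) (enum 'I_n) m).
      by move=> mn; rewrite (nth_map (Ordinal kn))// size_enum_ord.
    rewrite nthE 1?ltnW// nthE//.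
    by apply: sle; rewrite !nth_enum_ord// ltnW.
  - exact: singular_values_perm PA.
by rewrite (nth_map i) ?size_enum_ord// nth_ord_enum.
Qed.

(** Permuting the rows of a Takagi unitary sorts the diagonal. *)
Lemma takagi_sg n (A : 'M[C]_n) : A^T = A ->
  exists2 P : 'M[C]_n, P \is unitarymx & P *m A *m P^T = rdiag (fun i : 'I_n => sg A i).
Proof.
move=> /takagi_real[P Pu [s s0 PA]].
have sz : size (singular_values A) == n by rewrite size_singular_values.
have /tuple_permP[p svp] : perm_eq (Tuple sz) [tuple s i | i < n].
  by apply: (perm_trans (singular_values_perm Pu s0 PA)); rewrite /= perm_refl.
have sgE (i : 'I_n) : sg A i = s (p i).
  have -> : sg A i = nth 0 (Tuple sz) i by [].
  by rewrite svp (nth_map i) ?size_enum_ord// nth_ord_enum !tnth_mktuple.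
have PE (Q : 'M[C]_n) : row_perm p P *m Q = row_perm p (P *m Q).
  by apply/matrixP => i j; rewrite !mxE; apply: eq_bigr => k _; rewrite mxE.
exists (row_perm p P).
  apply/unitarymxP; rewrite PE; apply/matrixP => i j.
  have /matrixP/(_ (p i) (p j)) := unitarymxP Pu.
  rewrite !mxE (inj_eq perm_inj) => <-.
  by apply: eq_bigr => k _; rewrite !mxE.
rewrite PE; apply/matrixP => i j.
have /matrixP/(_ (p i) (p j)) := PA.
rewrite !rdiagE (inj_eq perm_inj) sgE => <-; rewrite !mxE.
by apply: eq_bigr => k _; rewrite !mxE.
Qed.

End SingularValues.

(** * Polynomial maps and their derivatives *)

Section PolynomialMaps.
Variables (R : realType) (p q : nat).
Local Notation W := 'M[R]_(p, q).

(** An inductive class closed under directional derivatives, so that the recursion defining [C_k]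
    can be followed with the sum and product rules alone. *)
Inductive polyf : (W -> R) -> Prop :=
| polyf_cst c : polyf (fun=> c)
| polyf_coord i j : polyf (fun X => X i j)
| polyfD f g : polyf f -> polyf g -> polyf (fun X => f X + g X)
| polyfM f g : polyf f -> polyf g -> polyf (fun X => f X * g X).

Lemma polyf_ext f g : f =1 g -> polyf f -> polyf g.
Proof. by move=> /funext ->. Qed.

Lemma polyfN f : polyf f -> polyf (fun X => - f X).
Proof.
move=> pf; apply: (@polyf_ext (fun X => -1 * f X)) => [X|]; first by rewrite mulN1r.
exact/polyfM/pf/polyf_cst.
Qed.

Lemma polyfB f g : polyf f -> polyf g -> polyf (fun X => f X - g X).
Proof. by move=> pf pg; exact: polyfD pf (polyfN pg). Qed.

Lemma polyf_differentiable f : polyf f -> forall x, differentiable f x.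
Proof.
elim=> {f} [c|i j|f g _ df _ dg|f g _ df _ dg] x.
- exact: differentiable_cst.
- exact: differentiable_coord.
- exact: differentiableD.
- exact: differentiableM.
Qed.

Lemma polyf_derivable f x v : polyf f -> derivable f x v.
Proof. by move=> pf; exact/diff_derivable/polyf_differentiable. Qed.

Lemma polyf_continuous f : polyf f -> continuous f.
Proof. by move=> pf x; exact/differentiable_continuous/polyf_differentiable. Qed.

Lemma polyf_near_neq0 f (x : W) : polyf f -> f x != 0 -> \forall X \near x, f X != 0.
Proof.
move=> /polyf_continuous/(_ x) fx.
exact: (@cvgr_neq0 _ _ _ (nbhs x) (nbhs_filter x) f (f x) fx).
Qed.

Lemma polyf_derive v f : polyf f -> polyf (fun x => 'D_v f x).
Proof.
elim=> {f} [c|i j|f g pf IHf pg IHg|f g pf IHf pg IHg].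
- by apply: (@polyf_ext (fun=> 0)) => [x|]; [rewrite derive_cst|exact: polyf_cst].
- apply: (@polyf_ext (fun=> v i j)) => [x|]; last exact: polyf_cst.
  have := @derive_id _ _ x v.
  rewrite (@derive_mx _ _ _ _ id x v); last exact: derivable_id.
  by move=> /matrixP/(_ i j); rewrite mxE.
- apply: (@polyf_ext (fun x => 'D_v f x + 'D_v g x)) => [x|]; last exact: polyfD.
  rewrite -deriveD//; exact: polyf_derivable.
- apply: (@polyf_ext (fun x => f x * 'D_v g x + g x * 'D_v f x)) => [x|].
    by rewrite -deriveM//; exact: polyf_derivable.
  by apply: polyfD; exact: polyfM.
Qed.

Lemma row_polyf_differentiable c (F : W -> 'rV[R]_c) :
  (forall j, polyf (fun X => F X 0 j)) -> forall x, differentiable F x.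
Proof.
move=> pF x.
have -> : F = \sum_(j < c) (fun X => F X 0 j *: 'e_j).
  apply/funext => X; rewrite fct_sumE [LHS]row_sum_delta.
  by apply: eq_bigr.
apply: differentiable_sum => j.
by apply: differentiableZl; exact: polyf_differentiable.
Qed.

Lemma row_polyf_smooth c (F : W -> 'rV[R]_c) (U : set W) :
  (forall j, polyf (fun X => F X 0 j)) -> smooth_on U F.
Proof.
move=> pF k; elim: k F pF => [|k IH] F pF /=.
  by move=> x _; exact/differentiable_continuous/row_polyf_differentiable.
split=> [x _|v]; first exact: row_polyf_differentiable.
apply: IH => j.
apply: (@polyf_ext (fun X => 'D_v (fun Y => F Y 0 j) X)) => [X|].
  rewrite derive_mx ?mxE//; exact/diff_derivable/row_polyf_differentiable.
exact: polyf_derive.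
Qed.

Lemma row_polyf_diff c (F : W -> 'rV[R]_c) x v j : 
  (forall j, polyf (fun X => F X 0 j)) ->
  'd F x v 0 j = 'D_v (fun X => F X 0 j) x.
Proof.
move=> pF; have dF := row_polyf_differentiable pF x.
by rewrite -deriveE// derive_mx ?mxE//; exact: diff_derivable.
Qed.

Lemma polyf_sum I (r : seq I) (P : pred I) (f : I -> W -> R) :
  (forall i, P i -> polyf (f i)) -> polyf (fun X => \sum_(i <- r | P i) f i X).
Proof.
move=> pf; elim: r => [|a r IH].
  by apply: (@polyf_ext (fun=> 0)) => [x|]; [rewrite big_nil|exact: polyf_cst].
have [Pa|Pa] := boolP (P a).
  apply: (@polyf_ext (fun X => f a X + \sum_(i <- r | P i) f i X)) => [x|].
    by rewrite big_cons Pa.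
  by apply: polyfD => //; exact: pf.
by apply: polyf_ext IH => x; rewrite big_cons (negbTE Pa).
Qed.

Lemma polyf_prod I (r : seq I) (f : I -> W -> R) :
  (forall i, polyf (f i)) -> polyf (fun X => \prod_(i <- r) f i X).
Proof.
move=> pf; elim: r => [|a r IH].
  by apply: (@polyf_ext (fun=> 1)) => [x|]; [rewrite big_nil|exact: polyf_cst].
apply: (@polyf_ext (fun X => f a X * \prod_(i <- r) f i X)) => [x|].
  by rewrite big_cons.
exact: polyfM.
Qed.

Lemma polyf_det k (M : W -> 'M[R]_k) : (forall i j, polyf (fun X => M X i j)) ->
  polyf (fun X => \det (M X)).
Proof.
move=> pM; apply: polyf_sum => s _; apply: polyfM; first exact: polyf_cst.
by apply: polyf_prod => i; exact: pM.
Qed.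

Lemma polyf_adj k (M : W -> 'M[R]_k) : (forall i j, polyf (fun X => M X i j)) ->
  forall i j, polyf (fun X => \adj (M X) i j).
Proof.
move=> pM i j.
apply: (@polyf_ext (fun X => (-1) ^+ (j + i) * \det (row' j (col' i (M X))))).
  by move=> x; rewrite mxE.
apply: polyfM; [exact: polyf_cst | apply: polyf_det => a b].
by apply: polyf_ext (pM (lift j a) (lift i b)) => x; rewrite !mxE.
Qed.

Lemma polyfM_derive x v f g : polyf f -> polyf g ->
  'D_v (fun X => f X * g X) x = f x * 'D_v g x + g x * 'D_v f x.
Proof. by move=> pf pg; rewrite deriveM//; exact: polyf_derivable. Qed.

Lemma polyf_prod_derive0 x v I (r : seq I) (f : I -> W -> R) :
  (forall i, polyf (f i)) -> (forall i, 'D_v (f i) x = 0) ->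
  'D_v (fun X => \prod_(i <- r) f i X) x = 0.
Proof.
move=> pf f0; elim: r => [|a r IH].
  have -> : (fun X => \prod_(i <- [::]) f i X) = (fun=> 1).
    by apply/funext => X; rewrite big_nil.
  by rewrite derive_cst.
have -> : (fun X => \prod_(i <- a :: r) f i X) =
    (fun X => f a X * \prod_(i <- r) f i X).
  by apply/funext => X; rewrite big_cons.
by rewrite polyfM_derive ?f0 ?IH ?mulr0 ?addr0//; exact: polyf_prod.
Qed.

Lemma polyf_sum_derive x v I (r : seq I) (f : I -> W -> R) :
  (forall i, polyf (f i)) ->
  'D_v (fun X => \sum_(i <- r) f i X) x = \sum_(i <- r) 'D_v (f i) x.
Proof.
move=> pf; elim: r => [|a r IH].
  have -> : (fun X => \sum_(i <- [::]) f i X) = (fun=> 0).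
    by apply/funext => X; rewrite big_nil.
  by rewrite derive_cst big_nil.
have -> : (fun X => \sum_(i <- a :: r) f i X) =
    (fun X => f a X + \sum_(i <- r) f i X).
  by apply/funext => X; rewrite big_cons.
rewrite deriveD ?IH ?big_cons//; apply/diff_derivable/polyf_differentiable => //.
by apply: polyf_sum => i _.
Qed.

(** Each term of the Leibniz expansion is stationary. Together with the adjugate version, this shows
    that the coefficients of [qpoly] are stationary in the test directions. *)
Lemma polyf_det_derive0 x v k (M : W -> 'M[R]_k) :
  (forall i j, polyf (fun X => M X i j)) ->
  (forall i j, 'D_v (fun X => M X i j) x = 0) -> 'D_v (fun X => \det (M X)) x = 0.
Proof.
move=> pM M0; rewrite polyf_sum_derive.
  rewrite big1// => s _; rewrite polyfM_derive; [|exact: polyf_cst|exact: polyf_prod].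
  by rewrite derive_cst polyf_prod_derive0// !mulr0 addr0.
by move=> s; apply: polyfM; [exact: polyf_cst|exact: polyf_prod].
Qed.

Lemma polyf_adj_derive0 x v k (M : W -> 'M[R]_k) :
  (forall i j, polyf (fun X => M X i j)) ->
  (forall i j, 'D_v (fun X => M X i j) x = 0) ->
  forall i j, 'D_v (fun X => \adj (M X) i j) x = 0.
Proof.
move=> pM M0 i j; pose N X := row' j (col' i (M X)).
have NE a b : (fun X => N X a b) = (fun X => M X (lift j a) (lift i b)).
  by apply/funext => X; rewrite !mxE.
have pN a b : polyf (fun X => N X a b) by rewrite NE.
have -> : (fun X => \adj (M X) i j) = (fun X => (-1) ^+ (j + i) * \det (N X)).
  by apply/funext => X; rewrite mxE.
rewrite polyfM_derive; [|exact: polyf_cst|exact: polyf_det].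
rewrite derive_cst mulr0 addr0 polyf_det_derive0 ?mulr0// => a b.
by rewrite NE.
Qed.

End PolynomialMaps.

Section ComplexPolynomialMaps.
Variables (R : realType) (p q : nat).
Local Notation W := 'M[R]_(p, q).
Local Notation C := R[i].

(** Polynomial over the reals: conjugation has to be allowed, so real and imaginary parts are
    tracked separately. *)
Definition cpolyf (G : W -> C) :=
  polyf (fun X => complex.Re (G X)) /\ polyf (fun X => complex.Im (G X)).

Lemma cpolyf_ext (G H : W -> C) : G =1 H -> cpolyf G -> cpolyf H.
Proof. by move=> /funext ->. Qed.

Lemma cpolyf_cst c : cpolyf (fun=> c).
Proof. by split; exact: polyf_cst. Qed.

Lemma cpolyf_real f : polyf f -> cpolyf (fun X => (f X)%:C).
Proof. by move=> pf; split=> //=; exact: polyf_cst. Qed.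

Lemma ReD (a b : C) : complex.Re (a + b) = complex.Re a + complex.Re b.
Proof. by case: a b => [? ?] []. Qed.
Lemma ImD (a b : C) : complex.Im (a + b) = complex.Im a + complex.Im b.
Proof. by case: a b => [? ?] []. Qed.
Lemma ReM (a b : C) :
  complex.Re (a * b) = complex.Re a * complex.Re b - complex.Im a * complex.Im b.
Proof. by case: a b => [? ?] []. Qed.
Lemma ImM (a b : C) :
  complex.Im (a * b) = complex.Re a * complex.Im b + complex.Im a * complex.Re b.
Proof. by case: a b => [? ?] []. Qed.
Lemma ReJ (a : C) : complex.Re (a^*)%R = complex.Re a.
Proof. by case: a. Qed.
Lemma ImJ (a : C) : complex.Im (a^*)%R = - complex.Im a.
Proof. by case: a. Qed.

Lemma cpolyfD G H : cpolyf G -> cpolyf H -> cpolyf (fun X => G X + H X).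
Proof.
move=> [rG iG] [rH iH]; split.
- by apply: polyf_ext (polyfD rG rH) => X; rewrite ReD.
- by apply: polyf_ext (polyfD iG iH) => X; rewrite ImD.
Qed.

Lemma cpolyfM G H : cpolyf G -> cpolyf H -> cpolyf (fun X => G X * H X).
Proof.
move=> [rG iG] [rH iH]; split.
- by apply: polyf_ext (polyfB (polyfM rG rH) (polyfM iG iH)) => X; rewrite ReM.
- by apply: polyf_ext (polyfD (polyfM rG iH) (polyfM iG rH)) => X; rewrite ImM.
Qed.

Lemma cpolyfJ G : cpolyf G -> cpolyf (fun X => (G X)^*%R).
Proof.
move=> [rG iG]; split.
- by apply: polyf_ext rG => X; rewrite ReJ.
- by apply: polyf_ext (polyfN iG) => X; rewrite ImJ.
Qed.

Lemma cpolyf_sum I (r : seq I) (G : I -> W -> C) :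
  (forall i, cpolyf (G i)) -> cpolyf (fun X => \sum_(i <- r) G i X).
Proof.
move=> pG; elim: r => [|a r IH].
  by apply: (@cpolyf_ext (fun=> 0)) => [x|]; [rewrite big_nil|exact: cpolyf_cst].
apply: (@cpolyf_ext (fun X => G a X + \sum_(i <- r) G i X)) => [x|].
  by rewrite big_cons.
exact: cpolyfD.
Qed.

Definition cderive (v x : W) (G : W -> C) : C :=
  Complex ('D_v (fun X => complex.Re (G X)) x) ('D_v (fun X => complex.Im (G X)) x).

Lemma cderive_cst v x c : cderive v x (fun=> c) = 0.
Proof. by rewrite /cderive !derive_cst. Qed.

Lemma cderiveD v x G H : cpolyf G -> cpolyf H ->
  cderive v x (fun X => G X + H X) = cderive v x G + cderive v x H.
Proof.
move=> [rG iG] [rH iH]; rewrite /cderive.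
have -> : (fun X => complex.Re (G X + H X)) =
  (fun X => complex.Re (G X) + complex.Re (H X)) by apply/funext => X; rewrite ReD.
have -> : (fun X => complex.Im (G X + H X)) =
  (fun X => complex.Im (G X) + complex.Im (H X)) by apply/funext => X; rewrite ImD.
by rewrite !deriveD//; exact: polyf_derivable.
Qed.

Lemma cderiveM v x G H : cpolyf G -> cpolyf H ->
  cderive v x (fun X => G X * H X) = cderive v x G * H x + G x * cderive v x H.
Proof.
move=> [rG iG] [rH iH]; rewrite /cderive.
have -> : (fun X => complex.Re (G X * H X)) =
  (fun X => complex.Re (G X) * complex.Re (H X) - complex.Im (G X) * complex.Im (H X)).
  by apply/funext => X; rewrite ReM.
have -> : (fun X => complex.Im (G X * H X)) =
  (fun X => complex.Re (G X) * complex.Im (H X) + complex.Im (G X) * complex.Re (H X)).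
  by apply/funext => X; rewrite ImM.
rewrite deriveB; [|exact/polyf_derivable/polyfM|exact/polyf_derivable/polyfM].
rewrite deriveD; [|exact/polyf_derivable/polyfM|exact/polyf_derivable/polyfM].
rewrite !polyfM_derive//.
by apply/eqP; rewrite eq_complex !ReD !ImD !ReM !ImM/=; apply/andP; split; apply/eqP; ring.
Qed.

Lemma cderiveJ v x G : cpolyf G ->
  cderive v x (fun X => (G X)^*%R) = (cderive v x G)^*%R.
Proof.
move=> [rG iG]; rewrite /cderive.
have -> : (fun X => complex.Re (G X)^*%R) = (fun X => complex.Re (G X)).
  by apply/funext => X; rewrite ReJ.
have -> : (fun X => complex.Im (G X)^*%R) = (fun X => - complex.Im (G X)).
  by apply/funext => X; rewrite ImJ.
by rewrite deriveN//; exact: polyf_derivable.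
Qed.

Lemma cderive_sum v x I (r : seq I) (G : I -> W -> C) : (forall i, cpolyf (G i)) ->
  cderive v x (fun X => \sum_(i <- r) G i X) = \sum_(i <- r) cderive v x (G i).
Proof.
move=> pG; elim: r => [|a r IH].
  have -> : (fun X => \sum_(i <- [::]) G i X) = (fun=> 0).
    by apply/funext => X; rewrite big_nil.
  by rewrite cderive_cst big_nil.
have -> : (fun X => \sum_(i <- a :: r) G i X) =
    (fun X => G a X + \sum_(i <- r) G i X).
  by apply/funext => X; rewrite big_cons.
by rewrite cderiveD ?IH ?big_cons//; exact: cpolyf_sum.
Qed.

Definition mpolyf m n (M : W -> 'M[C]_(m, n)) := forall i j, cpolyf (fun X => M X i j).
Definition mderive m n (v x : W) (M : W -> 'M[C]_(m, n)) : 'M[C]_(m, n) :=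
  \matrix_(i, j) cderive v x (fun X => M X i j).

Lemma mpolyf_cst m n (A : 'M[C]_(m, n)) : mpolyf (fun=> A).
Proof. by move=> i j; exact: cpolyf_cst. Qed.

Lemma mderive_cst m n v x (A : 'M[C]_(m, n)) : mderive v x (fun=> A) = 0.
Proof. by apply/matrixP => i j; rewrite !mxE cderive_cst. Qed.

Lemma mpolyfD m n (M N : W -> 'M[C]_(m, n)) :
  mpolyf M -> mpolyf N -> mpolyf (fun X => M X + N X).
Proof.
by move=> pM pN i j; apply: cpolyf_ext (cpolyfD (pM i j) (pN i j)) => X; rewrite mxE.
Qed.

Lemma mderiveD m n v x (M N : W -> 'M[C]_(m, n)) : mpolyf M -> mpolyf N ->
  mderive v x (fun X => M X + N X) = mderive v x M + mderive v x N.
Proof.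
move=> pM pN; apply/matrixP => i j; rewrite !mxE -cderiveD//; congr cderive.
by apply/funext => X; rewrite mxE.
Qed.

Lemma mpolyfM m n k (M : W -> 'M[C]_(m, n)) (N : W -> 'M[C]_(n, k)) :
  mpolyf M -> mpolyf N -> mpolyf (fun X => M X *m N X).
Proof.
move=> pM pN i j; apply: (@cpolyf_ext (fun X => \sum_l M X i l * N X l j)).
  by move=> X; rewrite mxE.
by apply: cpolyf_sum => l; exact: cpolyfM.
Qed.

Lemma mderiveM m n k v x (M : W -> 'M[C]_(m, n)) (N : W -> 'M[C]_(n, k)) :
  mpolyf M -> mpolyf N ->
  mderive v x (fun X => M X *m N X) = mderive v x M *m N x + M x *m mderive v x N.
Proof.
move=> pM pN; apply/matrixP => i j; rewrite !mxE -big_split/=.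
have -> : (fun X => (M X *m N X) i j) = (fun X => \sum_l M X i l * N X l j).
  by apply/funext => X; rewrite mxE.
rewrite cderive_sum; last by move=> l; exact: cpolyfM.
by apply: eq_bigr => l _; rewrite cderiveM// !mxE.
Qed.

Lemma mpolyfZ m n (g : W -> C) (M : W -> 'M[C]_(m, n)) :
  cpolyf g -> mpolyf M -> mpolyf (fun X => g X *: M X).
Proof.
by move=> pg pM i j; apply: cpolyf_ext (cpolyfM pg (pM i j)) => X; rewrite mxE.
Qed.

Lemma mderiveZ m n v x (g : W -> C) (M : W -> 'M[C]_(m, n)) : cpolyf g -> mpolyf M ->
  mderive v x (fun X => g X *: M X) = cderive v x g *: M x + g x *: mderive v x M.
Proof.
move=> pg pM; apply/matrixP => i j; rewrite !mxE -cderiveM//; congr cderive.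
by apply/funext => X; rewrite mxE.
Qed.

Lemma mpolyfJ m n (M : W -> 'M[C]_(m, n)) : mpolyf M -> mpolyf (fun X => cj (M X)).
Proof. by move=> pM i j; apply: cpolyf_ext (cpolyfJ (pM i j)) => X; rewrite mxE. Qed.

Lemma mderiveJ m n v x (M : W -> 'M[C]_(m, n)) : mpolyf M ->
  mderive v x (fun X => cj (M X)) = cj (mderive v x M).
Proof.
move=> pM; apply/matrixP => i j; rewrite !mxE -cderiveJ//; congr cderive.
by apply/funext => X; rewrite mxE.
Qed.

Lemma mpolyfT m n (M : W -> 'M[C]_(m, n)) : mpolyf M -> mpolyf (fun X => (M X)^T).
Proof. by move=> pM i j; apply: cpolyf_ext (pM j i) => X; rewrite mxE. Qed.

Lemma mderiveT m n v x (M : W -> 'M[C]_(m, n)) :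
  mderive v x (fun X => (M X)^T) = (mderive v x M)^T.
Proof.
apply/matrixP => i j; rewrite !mxE; congr cderive.
by apply/funext => X; rewrite mxE.
Qed.

Lemma mpolyf_sum m n k (M : 'I_k -> W -> 'M[C]_(m, n)) :
  (forall i, mpolyf (M i)) -> mpolyf (fun X => \sum_i M i X).
Proof.
move=> pM a b; apply: (@cpolyf_ext (fun X => \sum_i M i X a b)).
  by move=> X; rewrite summxE.
by apply: cpolyf_sum => i; exact: pM.
Qed.

Lemma mderive_sum m n k v x (M : 'I_k -> W -> 'M[C]_(m, n)) :
  (forall i, mpolyf (M i)) ->
  mderive v x (fun X => \sum_i M i X) = \sum_i mderive v x (M i).
Proof.
move=> pM; apply/matrixP => a b; rewrite summxE mxE.
have -> : (fun X => (\sum_i M i X) a b) = (fun X => \sum_i M i X a b).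
  by apply/funext => X; rewrite summxE.
rewrite cderive_sum; last by move=> i; exact: pM.
by apply: eq_bigr => i _; rewrite mxE.
Qed.

Lemma mpolyf_opow n (M : W -> 'M[C]_n) j : mpolyf M -> mpolyf (fun X => opow (M X) j).
Proof.
move=> pM; elim: j => // j IH; apply: mpolyfM => //; apply: mpolyfM => //.
exact: mpolyfJ.
Qed.

(** [opow (M X) j] is an alternating word of 2 j + 1 factors. Since [M x] is real, it acts on [V]
    and on conj(V), from either side, as the scalar [c]. Hence each of the j + 1 factors [M]
    contributes c^(2 j) V, and each of the j factors conj(M) contributes c^(2 j) conj(V). *)
Lemma mderive_opow n v x (M : W -> 'M[C]_n) (c : R) j : mpolyf M ->
  let V := mderive v x M in
  V *m M x = c%:C *: V -> M x *m V = c%:C *: V -> cj (M x) = M x ->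
  mderive v x (fun X => opow (M X) j) =
  (c ^+ j.*2)%:C *: (j.+1%:R *: V + j%:R *: cj V).
Proof.
move=> pM V VM MV Mr.
have cR : (c%:C)^*%R = c%:C :> C by exact: conjc_real.
have cVM : cj V *m M x = c%:C *: cj V by rewrite -[in LHS]Mr -cjM VM map_mxZ/= cR.
have opV i : opow (M x) i *m V = (c ^+ i.*2.+1)%:C *: V.
  elim: i => [|i IH]; first by rewrite expr1.
  rewrite opowS Mr -!mulmxA MV -!scalemxAr MV -scalemxAr IH !scalerA.
  by congr (_ *: _); rewrite -!rmorphM/= doubleS !exprS; congr (_%:C); ring.
have opVc i : opow (M x) i *m cj V = (c ^+ i.*2.+1)%:C *: cj V.
  have cMV : M x *m cj V = c%:C *: cj V by rewrite -[in LHS]Mr -cjM MV map_mxZ/= cR.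
  elim: i => [|i IH]; first by rewrite expr1.
  rewrite opowS Mr -!mulmxA cMV -!scalemxAr cMV -scalemxAr IH !scalerA.
  by congr (_ *: _); rewrite -!rmorphM/= doubleS !exprS; congr (_%:C); ring.
elim: j => [|j IH].
  by rewrite expr0 scale0r addr0 !scale1r.
rewrite (mderiveM v x (mpolyf_opow j pM) (mpolyfM (mpolyfJ pM) pM)) IH.
rewrite (mderiveM v x (mpolyfJ pM) pM) mderiveJ// -/V Mr mulmxDr.
rewrite cVM MV -!scalemxAr opV opVc.
rewrite -!scalemxAl mulmxDl -!scalemxAl !mulmxA VM cVM -!scalemxAl VM cVM.
have comb (K : comNzRingType) (L : lmodType K) (z e a b : K) (T U : L) :
    e *: (a *: (z *: (z *: T)) + b *: (z *: (z *: U))) +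
    (z *: ((z * e) *: U) + z *: ((z * e) *: T)) =
    (z * (z * e)) *: ((a + 1) *: T + (b + 1) *: U).
  rewrite !scalerDr !scalerA [X in _ + X]addrC addrACA -!scalerDl.
  by congr (_ *: _ + _ *: _); ring.
by rewrite doubleS !exprS !rmorphM/= comb !natr1.
Qed.

End ComplexPolynomialMaps.

(** * The interpolated odd polynomial *)

Section OddPolynomials.
Variable R : realType.
Local Notation C := R[i].

(** The matrix Y p(conj(Y) Y). The number of terms [m] is explicit, so that the range of the sum
    stays fixed when the coefficients vary with [Y]. *)
Definition oddp n m (p : {poly R}) (Y : 'M[C]_n) : 'M[C]_n :=
  \sum_(j < m) (p`_j)%:C *: opow Y j.

Lemma oddpB n m (p q : {poly R}) (Y : 'M[C]_n) :
  oddp m (p - q) Y = oddp m p Y - oddp m q Y.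
Proof.
rewrite /oddp -sumrB; apply: eq_bigr => j _.
by rewrite coefB rmorphB/= scalerBl.
Qed.

Lemma oddpZ n m (c : R) (p : {poly R}) (Y : 'M[C]_n) :
  oddp m (c *: p) Y = c%:C *: oddp m p Y.
Proof.
rewrite /oddp scaler_sumr; apply: eq_bigr => j _.
by rewrite coefZ rmorphM/= scalerA.
Qed.

Lemma oddp0 n m (Y : 'M[C]_n) : oddp m 0 Y = 0.
Proof. by rewrite /oddp big1// => j _; rewrite coef0 scale0r. Qed.

Lemma tr_oddp n m (p : {poly R}) (Y : 'M[C]_n) : Y^T = Y -> (oddp m p Y)^T = oddp m p Y.
Proof.
move=> YT; rewrite /oddp [LHS]raddf_sum; apply: eq_bigr => j _.
by rewrite /= linearZ/= tr_opow.
Qed.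

Lemma mul_oddp_cj n m (p : {poly R}) (Y : 'M[C]_n) :
  oddp m p Y *m cj Y = Y *m cj (oddp m p Y).
Proof.
rewrite /oddp mulmx_suml [X in Y *m X]raddf_sum mulmx_sumr; apply: eq_bigr => j _.
by rewrite /= map_mxZ/= conjC_real -scalemxAl -scalemxAr mul_opow_cj.
Qed.

Lemma opow_rdiag n (s : 'I_n -> R) j :
  opow (rdiag s) j = rdiag (fun i => s i * (s i ^+ 2) ^+ j).
Proof.
elim: j => [|j IH]; first by apply: eq_rdiag => i; rewrite expr0 mulr1.
rewrite opowS IH cj_rdiag !rdiagM; apply: eq_rdiag => i.
by rewrite [_ ^+ j.+1]exprSr [RHS]mulrA -expr2.
Qed.

Lemma oddp_congr n m (p : {poly R}) (P Y : 'M[C]_n) (s : 'I_n -> R) :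
  P \is unitarymx -> P *m Y *m P^T = rdiag s -> (size p <= m)%N ->
  P *m oddp m p Y *m P^T = rdiag (fun i => s i * p.[s i ^+ 2]).
Proof.
move=> Pu PY pm; rewrite /oddp mulmx_sumr mulmx_suml.
under eq_bigr do rewrite -scalemxAr -scalemxAl -opow_congr// PY opow_rdiag.
apply/matrixP => a b; rewrite summxE rdiagE.
case: (eqVneq a b) => [<-|ab].
  rewrite (horner_coef_wide _ pm) mulr_sumr rmorph_sum/=; apply: eq_bigr => j _.
  by rewrite mxE rdiagE eqxx -rmorphM/= mulrCA.
by rewrite big1// => j _; rewrite mxE rdiagE (negbTE ab) mulr0.
Qed.

Lemma oddp_eq0 n m (p : {poly R}) (P Y : 'M[C]_n) (s : 'I_n -> R) :
  P \is unitarymx -> P *m Y *m P^T = rdiag s -> (size p <= m)%N ->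
  (forall i, s i * p.[s i ^+ 2] = 0) <-> oddp m p Y = 0.
Proof.
move=> Pu PY pm; have E := oddp_congr Pu PY pm; split=> [s0|o0 i].
  rewrite (unitary_congrK Pu E) (_ : rdiag _ = 0) ?mulmx0 ?mul0mx//.
  by apply/matrixP => i j; rewrite rdiagE s0 mxE; case: ifP.
move: E; rewrite o0 mulmx0 mul0mx => /matrixP/(_ i i).
by rewrite rdiagE eqxx mxE => -[].
Qed.

(* [sg] is indexed from 0 and [sg A n = 0], so the last index belongs to
   [degen A] when [0] is a singular value of [A]. *)
Definition degen n (A : 'M[C]_n) : {set 'I_n} := [set i : 'I_n | sg A i == sg A i.+1].

Lemma degenP n (A : 'M[C]_n) (i : 'I_n) :
  reflect (sg A i = sg A i.+1) (i \in degen A).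
Proof. by rewrite inE; exact: eqP. Qed.

Lemma notin_degen n (A : 'M[C]_n) (i : 'I_n) : i \notin degen A -> sg A i.+1 < sg A i.
Proof. by rewrite inE eq_sym lt_neqAle => ->; exact: sg_le. Qed.

Lemma notin_degen_gt0 n (A : 'M[C]_n) (i : 'I_n) : i \notin degen A -> 0 < sg A i.
Proof. by move=> /notin_degen; apply: le_lt_trans; exact: sg_ge0. Qed.

Lemma sg_inj_notin n (A : 'M[C]_n) : {in ~: degen A &, injective (fun i : 'I_n => sg A i)}.
Proof.
suff H (i j : 'I_n) : i \notin degen A -> (i < j)%N -> sg A j < sg A i.
  move=> i j; rewrite !finset.in_setC => iA jA E; apply/val_inj.
  by case: (ltngtP i j) => // ij; [have := H _ _ iA ij|have := H _ _ jA ij]; rewrite E ltxx.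
by move=> /notin_degen iA ij; apply: le_lt_trans iA; exact: sg_le.
Qed.

(** [r] is the last index of the block of [l]; positivity keeps this block from continuing past the
    end, where [sg] is 0. *)
Lemma exists_notin_degen n (A : 'M[C]_n) (l : 'I_n) : 0 < sg A l ->
  exists2 r : 'I_n, r \notin degen A & sg A r = sg A l.
Proof.
move=> l0; pose Pr (r : 'I_n) := sg A r == sg A l.
have Pl : Pr l by exact: eqxx.
case: (arg_maxnP (fun r : 'I_n => r : nat) Pl) => r /eqP rl rmax.
exists r => //; apply/negP => /degenP rE.
have [rn|rn] := ltnP r.+1 n.
  have := rmax (Ordinal rn); rewrite /Pr /= -rE rl eqxx => /(_ isT).
  by rewrite ltnn.
by move: l0; rewrite -rl rE sg_default// ltxx.
Qed.

Section Interpolation.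
Variables (n : nat) (t : {set 'I_n}).
Local Notation k := #|~: t|.

(** For [t = degen A], the indices off [t] are the last ones of the blocks of equal positive
    singular values: one representative per block. *)
Definition rep (i : 'I_k) : 'I_n := enum_val i.

Lemma rep_notin i : rep i \notin t.
Proof. by have := enum_valP i; rewrite finset.in_setC. Qed.

Definition vmat (Y : 'M[C]_n) : 'M[R]_k :=
  \matrix_(i, j) complex.Re (opow Y j (rep i) (rep i)).
Definition vrhs (Y : 'M[C]_n) : 'cV[R]_k :=
  \col_i complex.Re (opow Y k (rep i) (rep i)).
(** Cramer's rule: if [\det (vmat Y)] is nonzero, this is that determinant times the solution [c] of
    [vmat Y c = vrhs Y]. *)
Definition kcoef (Y : 'M[C]_n) : 'cV[R]_k := \adj (vmat Y) *m vrhs Y.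

(* The polynomial [q] of degree at most [k] with leading coefficient
   [\det (vmat Y)] such that the diagonal entries of Y q(conj(Y) Y) at the
   representatives have no real part; its coefficients are polynomial in [Y]. *)
Definition qpoly (Y : 'M[C]_n) : {poly R} :=
  \det (vmat Y) *: 'X^k - \poly_(j < k) (if insub j is Some i then kcoef Y i 0 else 0).

Lemma coef_qpoly_lt Y (j : 'I_k) : (qpoly Y)`_j = - kcoef Y j 0.
Proof.
rewrite coefB coefZ coefXn coef_poly ltn_ord valK.
by rewrite (ltn_eqF (ltn_ord j)) mulr0 sub0r.
Qed.

Lemma coef_qpoly_eq Y : (qpoly Y)`_k = \det (vmat Y).
Proof. by rewrite coefB coefZ coefXn coef_poly ltnn eqxx mulr1 subr0. Qed.

Lemma size_qpoly_le Y : (size (qpoly Y) <= k.+1)%N.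
Proof.
rewrite (leq_trans (size_polyD _ _))// geq_max size_polyN.
rewrite (leq_trans (size_scale_leq _ _)) ?size_polyXn//=.
by rewrite (leq_trans (size_poly _ _)).
Qed.

Lemma size_qpoly Y : \det (vmat Y) != 0 -> size (qpoly Y) = k.+1.
Proof.
move=> dY; apply/eqP; rewrite eqn_leq size_qpoly_le/= ltnNge; apply/negP => sz.
by move: dY; rewrite -coef_qpoly_eq nth_default ?eqxx.
Qed.

Definition keq (Y : 'M[C]_n) : 'M[C]_n := oddp k.+1 (qpoly Y) Y.

Lemma Re_oddp m (p : {poly R}) (Y : 'M[C]_n) a b :
  complex.Re (oddp m p Y a b) = \sum_(j < m) p`_j * complex.Re (opow Y j a b).
Proof.
rewrite /oddp summxE (big_morph _ (@ReD R) (erefl : complex.Re (0 : C) = 0)).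
by apply: eq_bigr => j _; rewrite mxE ReM/= mul0r subr0.
Qed.

Lemma keq_rep Y i : complex.Re (keq Y (rep i) (rep i)) = 0.
Proof.
rewrite /keq Re_oddp big_ord_recr/= coef_qpoly_eq.
under eq_bigr do rewrite coef_qpoly_lt mulNr.
rewrite sumrN.
have : (vmat Y *m kcoef Y) i 0 = \det (vmat Y) * vrhs Y i 0.
  by rewrite mulmxA mul_mx_adj mul_scalar_mx mxE.
rewrite mxE [in RHS]mxE => <-; rewrite addrC; apply/eqP; rewrite subr_eq0; apply/eqP.
by apply: eq_bigr => j _; rewrite [vmat _ _ _]mxE mulrC.
Qed.

(** Uniqueness of the interpolation: the conditions at the representatives form a linear system with
    matrix [vmat Y]. *)
Lemma oddp_rep_eq0 (Y : 'M[C]_n) (g : {poly R}) : \det (vmat Y) != 0 ->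
  (size g <= k)%N -> (forall i, complex.Re (oddp k.+1 g Y (rep i) (rep i)) = 0) -> g = 0.
Proof.
move=> dY gk g0; pose c : 'cV[R]_k := \col_j g`_j.
have Vc : vmat Y *m c = 0.
  apply/matrixP => i j; have := g0 i.
  rewrite Re_oddp big_ord_recr/= (nth_default 0 gk) mul0r addr0 !mxE; apply: etrans.
  by apply: eq_bigr => l _; rewrite !mxE mulrC.
have c0 : c = 0.
  have Vu : vmat Y \in unitmx by rewrite unitmxE unitfE.
  by rewrite -(mulKmx Vu c) Vc mulmx0.
apply/polyP => j; rewrite coef0; have [jk|jk] := ltnP j k.
  by have /matrixP/(_ (Ordinal jk) 0) := c0; rewrite !mxE.
by rewrite nth_default// (leq_trans gk).
Qed.

(** The monic polynomial [p] whose roots are the squares of the k distinct positive singular values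
    satisfies Y p(conj(Y) Y) = 0. Then [qpoly Y - \det (vmat Y) *: p] has degree below k and meets
    the conditions at the representatives, so it is 0. *)
Lemma keq_vanish (Y : 'M[C]_n) : Y^T = Y -> degen Y = t -> \det (vmat Y) != 0 ->
  keq Y = 0.
Proof.
move=> YT Yt dY; have [Q Qu QY] := takagi_sg YT.
pose zs := [seq sg Y (rep i) ^+ 2 | i <- enum 'I_k].
pose p := \prod_(z <- zs) ('X - z%:P).
have pk : size p = k.+1 by rewrite size_prod_XsubC size_map size_enum_ord.
have p0 : oddp k.+1 p Y = 0.
  apply/(oddp_eq0 Qu QY); first by rewrite pk.
  move=> i; have [i0|] := ltP 0 (sg Y i); last first.
    by move=> si; rewrite (_ : sg Y i = 0) ?mul0r//; apply/le_anti; rewrite si sg_ge0.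
  have [r rt <-] := exists_notin_degen i0.
  apply/eqP; rewrite mulf_eq0; apply/orP; right.
  rewrite -/(root p _) root_prod_XsubC; apply/mapP.
  have rk : r \in ~: t by rewrite finset.in_setC -Yt.
  by exists (enum_rank_in rk r); rewrite ?mem_enum// /rep enum_rankK_in.
pose g := qpoly Y - \det (vmat Y) *: p.
have gk : (size g <= k)%N.
  have pm : p`_k = 1.
    by have /monicP := monic_prod_XsubC zs xpredT id; rewrite lead_coefE -/p pk.
  apply/leq_sizeP => j; rewrite leq_eqVlt => /orP[/eqP<-|kj].
    by rewrite coefB coefZ coef_qpoly_eq pm mulr1 subrr.
  rewrite coefB coefZ !nth_default ?mulr0 ?subr0 ?pk//.
  exact: leq_trans (size_qpoly_le _) kj.
have kg : keq Y = oddp k.+1 g Y by rewrite oddpB oddpZ p0 scaler0 subr0.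
by rewrite kg (oddp_rep_eq0 dY gk) ?oddp0// => i; rewrite -kg keq_rep.
Qed.

(** The squares of the distinct positive singular values of [Y] are roots of [qpoly Y], which has
    degree k. So at most k indices lie off [degen Y], and the inclusion in [t] becomes an
    equality. *)
Lemma keq_degen (Y : 'M[C]_n) : Y^T = Y -> degen Y \subset t -> \det (vmat Y) != 0 ->
  keq Y = 0 -> degen Y = t.
Proof.
move=> YT Yt dY K0; have [Q Qu QY] := takagi_sg YT.
have q0 i : i \notin degen Y -> root (qpoly Y) (sg Y i ^+ 2).
  move=> iY; have := (oddp_eq0 Qu QY (size_qpoly_le Y)).2 K0 i.
  by move/eqP; rewrite mulf_eq0 gt_eqF ?notin_degen_gt0.
pose rs := [seq sg Y (i : 'I_n) ^+ 2 | i <- enum (~: degen Y)].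
have urs : uniq rs.
  rewrite map_inj_in_uniq ?enum_uniq// => i j; rewrite !mem_enum => iY jY /eqP.
  rewrite eqrXn2 ?sg_ge0// => /eqP; exact: sg_inj_notin.
have ars : all (root (qpoly Y)) rs.
  by rewrite all_map; apply/allP => i; rewrite mem_enum finset.in_setC => iY; exact: q0.
have qn0 : qpoly Y != 0 by rewrite -size_poly_eq0 size_qpoly.
have := max_poly_roots qn0 ars urs; rewrite size_qpoly// size_map -cardE ltnS => le.
apply/finset.setC_inj/esym/eqP; rewrite eqEcard le andbT.
by rewrite finset.setCS.
Qed.

Lemma vmat_rdiag (s : 'I_n -> R) i j :
  vmat (rdiag s) i j = s (rep i) * (s (rep i) ^+ 2) ^+ j.
Proof. by rewrite mxE opow_rdiag rdiagE eqxx. Qed.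

Lemma det_vmat_rdiag (s : 'I_n -> R) : (forall i, i \notin t -> 0 < s i) ->
  {in ~: t &, injective s} -> \det (vmat (rdiag s)) != 0.
Proof.
move=> s0 sinj.
have -> : vmat (rdiag s) = diag_mx (\row_i s (rep i)) *m
    (Vandermonde k (\row_i s (rep i) ^+ 2))^T.
  by apply/matrixP => i j; rewrite mul_diag_mx vmat_rdiag !mxE.
rewrite det_mulmx det_diag det_tr det_Vandermonde mulf_neq0//.
  by apply/prodf_neq0 => i _; rewrite mxE gt_eqF// s0// rep_notin.
apply/prodf_neq0 => i _; apply/prodf_neq0 => j ij; rewrite !mxE subr_eq0.
rewrite eqrXn2 ?(ltW (s0 _ (rep_notin _)))//; apply/eqP => /sinj.
rewrite !finset.in_setC !rep_notin => /(_ isT isT) /enum_val_inj E.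
by rewrite E ltnn in ij.
Qed.

(** The condition at a representative reads s q(s^2) = 0 with s > 0, which gives k distinct roots
    for a polynomial of degree k. *)
Lemma qpoly_rdiag (s : 'I_n -> R) : (forall i, i \notin t -> 0 < s i) ->
  {in ~: t &, injective s} ->
  qpoly (rdiag s) = \det (vmat (rdiag s)) *: \prod_(i < k) ('X - (s (rep i) ^+ 2)%:P).
Proof.
move=> s0 sinj; set Y := rdiag s; have dY := det_vmat_rdiag s0 sinj.
have lq : lead_coef (qpoly Y) = \det (vmat Y).
  by rewrite lead_coefE size_qpoly// coef_qpoly_eq.
have -> : \prod_(i < k) ('X - (s (rep i) ^+ 2)%:P) =
    \prod_(z <- [seq s (rep i) ^+ 2 | i <- enum 'I_k]) ('X - z%:P).
  by rewrite big_map big_enum.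
rewrite -lq; apply: all_roots_prod_XsubC.
- by rewrite size_qpoly// size_map size_enum_ord.
- apply/allP => z /mapP[i _ ->]; apply/eqP.
  have /matrixP/(_ (rep i) (rep i)) : oddp k.+1 (qpoly Y) Y =
      rdiag (fun i => s i * (qpoly Y).[s i ^+ 2]).
    have := @oddp_congr n k.+1 (qpoly Y) 1%:M Y s.
    rewrite trmx1 !mul1mx !mulmx1; apply; rewrite ?size_qpoly_le//.
    by apply/unitarymxP; rewrite trmx1 map_mx1 mulmx1.
  rewrite rdiagE eqxx -/(keq Y) => /(congr1 (@complex.Re R)); rewrite keq_rep/=.
  by move/esym/eqP; rewrite mulf_eq0 gt_eqF ?s0 ?rep_notin// => /eqP.
- rewrite uniq_rootsE map_inj_uniq ?enum_uniq// => i j /eqP.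
  rewrite eqrXn2 ?(ltW (s0 _ (rep_notin _)))// => /eqP /sinj.
  by rewrite !finset.in_setC !rep_notin => /(_ isT isT) /enum_val_inj.
Qed.

Lemma qpoly_rdiag0 (s : 'I_n -> R) : (forall i, i \notin t -> 0 < s i) ->
  {in ~: t &, injective s} -> (qpoly (rdiag s)).[0] != 0.
Proof.
move=> s0 sinj; rewrite qpoly_rdiag// hornerZ mulf_neq0 ?det_vmat_rdiag//.
rewrite horner_prod; apply/prodf_neq0 => i _.
by rewrite hornerXsubC sub0r oppr_eq0 expf_neq0// gt_eqF// s0 ?rep_notin.
Qed.

Lemma qpoly_rdiag_root (s : 'I_n -> R) r : (forall i, i \notin t -> 0 < s i) ->
  {in ~: t &, injective s} -> r \notin t ->
  (qpoly (rdiag s)).[s r ^+ 2] = 0 /\ (qpoly (rdiag s))^`().[s r ^+ 2] != 0.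
Proof.
move=> s0 sinj rt; rewrite qpoly_rdiag//.
have rk : r \in ~: t by rewrite finset.in_setC.
pose i0 := enum_rank_in rk r; have ri0 : rep i0 = r by rewrite /rep enum_rankK_in.
rewrite (bigD1 i0)//= ri0; set h := \prod_(i < k | _) _; split.
  by rewrite hornerZ hornerM hornerXsubC subrr mul0r mulr0.
rewrite derivZ hornerZ mulf_neq0 ?det_vmat_rdiag// derivM derivXsubC mul1r.
rewrite hornerD hornerM hornerXsubC subrr mul0r addr0 horner_prod.
apply/prodf_neq0 => i ii0; rewrite hornerXsubC subr_eq0.
rewrite eqrXn2 ?(ltW (s0 _ _)) ?rep_notin//; apply: contraNneq ii0.
rewrite -ri0 => /sinj; rewrite !finset.in_setC !rep_notin => /(_ isT isT) /enum_val_inj ->.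
exact: eqxx.
Qed.

End Interpolation.
End OddPolynomials.

(** * Real coordinates on complex matrices *)

Section RealCoordinates.
Variables (R : realType) (n : nat).
Local Notation C := R[i].
Local Notation W := 'M[R]_(n, n + n).

Definition cplx (X : W) : 'M[C]_n :=
  \matrix_(i, j) Complex (X i (lshift n j)) (X i (rshift n j)).

Lemma realifyK (A : 'M[C]_n) : cplx (realify A) = A.
Proof.
apply/matrixP => i j; rewrite mxE /realify row_mxEl row_mxEr !mxE.
by case: (A i j).
Qed.

Lemma cplxK (X : W) : realify (cplx X) = X.
Proof.
apply/matrixP => i j; rewrite /realify mxE.
case: split_ordP => k ->; by rewrite !mxE.
Qed.

Lemma mpolyf_cplx : mpolyf cplx.
Proof.
move=> i j; split.
- by apply: polyf_ext (@polyf_coord R n (n + n) i (lshift n j)) => X; rewrite mxE.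
- by apply: polyf_ext (@polyf_coord R n (n + n) i (rshift n j)) => X; rewrite mxE.
Qed.

Lemma mderive_cplx v x : mderive v x cplx = cplx v.
Proof.
have dcoord i j : 'D_v (fun X : W => X i j) x = v i j.
  have := @derive_id _ _ x v.
  rewrite (@derive_mx _ _ _ _ id x v); last exact: derivable_id.
  by move=> /matrixP/(_ i j); rewrite mxE.
apply/matrixP => i j; rewrite !mxE /cderive.
have -> : (fun X => complex.Re (cplx X i j)) = (fun X => X i (lshift n j)).
  by apply/funext => X; rewrite mxE.
have -> : (fun X => complex.Im (cplx X i j)) = (fun X => X i (rshift n j)).
  by apply/funext => X; rewrite mxE.
by rewrite !dcoord.
Qed.

Lemma cpolyf_near (G : W -> C) (x : W) (e : R) : cpolyf G -> 0 < e ->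
  \forall X \near x, `|G X - G x| <= e%:C.
Proof.
move=> [/polyf_continuous rG /polyf_continuous iG] e0.
have e20 : 0 < e / 2 by rewrite divr_gt0.
have hr : \forall X \near x, `|complex.Re (G x) - complex.Re (G X)| <= e / 2.
  exact: (cvgrPdist_le _ _).1 (rG x) _ e20.
have hi : \forall X \near x, `|complex.Im (G x) - complex.Im (G X)| <= e / 2.
  exact: (cvgrPdist_le _ _).1 (iG x) _ e20.
have Fx : Filter (nbhs x) by exact: nbhs_filter.
apply: filterS2 hr hi => X rX iX; rewrite [G X - G x]complexE.
apply: (le_trans (ler_normD _ _)); rewrite normrM (normCi _) mul1r.
have nR (r : R) : `|r%:C| = `|r|%:C :> C.
  by rewrite normc_def /= expr0n addr0 sqrtr_sqr.
rewrite !nR -rmorphD/= lecR (splitr e) lerD//.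
- by rewrite ReD; case: (G x) rX => a b /=; rewrite distrC.
- by rewrite ImD; case: (G x) iX => a b /=; rewrite distrC.
Qed.

Lemma mpolyf_near m k (M : W -> 'M[C]_(m, k)) (x : W) (e : R) : mpolyf M -> 0 < e ->
  \forall X \near x, forall i j, `|(M X - M x) i j| <= e%:C.
Proof.
move=> pM e0.
have H (ij : 'I_m * 'I_k) : \forall X \near x, `|(M X - M x) ij.1 ij.2| <= e%:C.
  have := cpolyf_near x (pM ij.1 ij.2) e0.
  by apply: filterS => X; rewrite !mxE.
have : \forall X \near x, forall ij : 'I_m * 'I_k, `|(M X - M x) ij.1 ij.2| <= e%:C.
  exact: (@filter_forall _ _
    (fun (ij : 'I_m * 'I_k) X => `|(M X - M x) ij.1 ij.2| <= e%:C) _ (nbhs_filter x) H).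
by apply: filterS => X HX i j; exact: HX (i, j).
Qed.

End RealCoordinates.

(** * Persistence of gaps between singular values *)

Section SingularValuePerturbation.
Variable R : realType.
Local Notation C := R[i].

Lemma sg_congr n (P Y : 'M[C]_n) : P \is unitarymx -> Y^T = Y ->
  forall i, sg (P *m Y *m P^T) i = sg Y i.
Proof.
move=> Pu YT i; have [ni|ni] := leqP n i; first by rewrite !sg_default.
have sPY : (P *m Y *m P^T)^T = P *m Y *m P^T by rewrite !trmx_mul trmxK YT mulmxA.
have [Q Qu QY] := takagi_sg sPY.
have QPu := unitarymxM Qu Pu.
have QPY : Q *m P *m Y *m (Q *m P)^T = rdiag (fun j : 'I_n => sg (P *m Y *m P^T) j).
  by rewrite trmx_mul -QY !mulmxA.
by rewrite (sg_unique QPu _ _ QPY (Ordinal ni))// => [j|j l]; [exact: sg_ge0|exact: sg_le].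
Qed.

Lemma degen_congr n (P Y : 'M[C]_n) : P \is unitarymx -> Y^T = Y ->
  degen (P *m Y *m P^T) = degen Y.
Proof. by move=> Pu YT; apply/setP => i; rewrite !inE !sg_congr. Qed.

Lemma sg_perturbation n (A B : 'M[C]_n) (d : R) (l : 'I_n) : A^T = A -> B^T = B ->
  (forall i j, `|(A^t* *m A - B^t* *m B) i j| <= d%:C) ->
  sg A l ^+ 2 <= sg B l ^+ 2 + n%:R * d.
Proof.
move=> AT BT ABd; have [P Pu PA] := takagi_sg AT; have [Q Qu QB] := takagi_sg BT.
have nC : (n%:R : C) = (n%:R : R)%:C by rewrite rmorph_nat.
have := eigenvalue_perturbation (unitarymxJ Pu) (unitarymxJ Qu) (congr_rdiag_gram Pu PA)
  (congr_rdiag_gram Qu QB) (l := l) _ _ ABd _ _.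
have sE : (sg B l ^+ 2 + n%:R * d)%:C = (sg B l ^+ 2)%:C + n%:R * d%:C.
  by rewrite nC -rmorphM -rmorphD.
rewrite !mxE -sE lecR; apply.
- by move=> i il; rewrite !mxE lecR ler_pXn2r ?nnegrE ?sg_ge0// sg_le.
- by move=> i il; rewrite !mxE lecR ler_pXn2r ?nnegrE ?sg_ge0// sg_le.
- by move=> i; rewrite mxE complex_real.
- by move=> i; rewrite mxE complex_real.
Qed.

Lemma degen_near n (A : 'M[C]_n) : A^T = A ->
  \forall X \near realify A, (cplx X)^T = cplx X -> degen (cplx X) \subset degen A.
Proof.
move=> AT.
have H (l : 'I_n) : \forall X \near realify A, (cplx X)^T = cplx X ->
    l \in degen (cplx X) -> l \in degen A.
  have [lA|lA] := boolP (l \in degen A).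
    by apply: (@filterE _ _ (nbhs_filter (realify A))) => X _ _.
  have gap : 0 < sg A l ^+ 2 - sg A l.+1 ^+ 2.
    by rewrite subr_gt0 ltr_pXn2r ?nnegrE ?sg_ge0// notin_degen.
  have n0 : 0 < 2 * n%:R + 1 :> R by rewrite ltr_wpDl ?mulr_ge0 ?ler0n ?ltr01.
  (* The two squares move by at most n d each, and 2 n d is less than the gap (2 n + 1) d. *)
  pose d := (sg A l ^+ 2 - sg A l.+1 ^+ 2) / (2 * n%:R + 1).
  have d0 : 0 < d by rewrite divr_gt0.
  have pG : mpolyf (fun X : 'M[R]_(n, n + n) => (cplx X)^t* *m cplx X).
    apply: mpolyfM; last exact: mpolyf_cplx.
    exact/mpolyfJ/mpolyfT/mpolyf_cplx.
  have := mpolyf_near (realify A) pG d0; apply: filterS => X; rewrite realifyK => Xd XT.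
  move=> /degenP Xl.
  have dX i j : `|(A^t* *m A - (cplx X)^t* *m cplx X) i j| <= d%:C.
    by rewrite -opprB mxE normrN.
  have h1 := sg_perturbation l AT XT dX.
  have h2 : sg (cplx X) l.+1 ^+ 2 <= sg A l.+1 ^+ 2 + n%:R * d.
    have [nl|nl] := leqP n l.+1.
      by rewrite !sg_default// lerDl mulr_ge0// ltW.
    exact: (@sg_perturbation _ _ _ _ (Ordinal nl) XT AT Xd).
  have : sg A l ^+ 2 - sg A l.+1 ^+ 2 = d * (2 * n%:R + 1) by rewrite divfK// gt_eqF.
  by move: h1 h2; rewrite Xl; lra.
have : \forall X \near realify A, forall l : 'I_n, (cplx X)^T = cplx X ->
    l \in degen (cplx X) -> l \in degen A.
  exact: (@filter_forall _ _ (fun (l : 'I_n) X => (cplx X)^T = cplx X ->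
    l \in degen (cplx X) -> l \in degen A) _ (nbhs_filter (realify A)) H).
apply: filterS => X HX XT.
by apply/fintype.subsetP => l; exact: HX.
Qed.

End SingularValuePerturbation.

(** * Differential of the interpolated odd polynomial *)

Section KeqPolynomial.
Variables (R : realType) (p q n : nat) (t : {set 'I_n}).
Local Notation C := R[i].
Local Notation W := 'M[R]_(p, q).
Local Notation k := #|~: t|.
Variables (M : W -> 'M[C]_n) (pM : mpolyf M).

Lemma polyf_vmat i j : polyf (fun X => vmat t (M X) i j).
Proof.
have [+ _] := mpolyf_opow j pM (rep i) (rep i).
by apply: polyf_ext => X; rewrite mxE.
Qed.

Lemma polyf_vrhs i j : polyf (fun X => vrhs t (M X) i j).
Proof.
have [+ _] := mpolyf_opow k pM (rep i) (rep i).
by apply: polyf_ext => X; rewrite mxE.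
Qed.

Lemma kcoefE X i j : kcoef t (M X) i j = \sum_l \adj (vmat t (M X)) i l * vrhs t (M X) l j.
Proof. by rewrite mxE. Qed.

Lemma polyf_kcoef i j : polyf (fun X => kcoef t (M X) i j).
Proof.
apply: (@polyf_ext _ _ _ (fun X => \sum_l \adj (vmat t (M X)) i l * vrhs t (M X) l j)).
  by move=> X; rewrite kcoefE.
apply: polyf_sum => l _; apply: polyfM; last exact: polyf_vrhs.
by apply: polyf_adj => a b; exact: polyf_vmat.
Qed.

Lemma coef_qpolyE (Y : 'M[C]_n) (j : 'I_k.+1) : (qpoly t Y)`_j =
  if (insub (j : nat) : option 'I_k) is Some i then - kcoef t Y i 0 else \det (vmat t Y).
Proof.
case: insubP => [i ik ij|]; first by rewrite -ij coef_qpoly_lt.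
rewrite -leqNgt => kj; rewrite (_ : (j : nat) = k) ?coef_qpoly_eq//.
by apply/eqP; rewrite eqn_leq kj -ltnS ltn_ord.
Qed.

Lemma polyf_qpoly (j : 'I_k.+1) : polyf (fun X => (qpoly t (M X))`_j).
Proof.
under [X in polyf X]funext do rewrite coef_qpolyE.
case: insubP => [i _ _|_]; first exact/polyfN/polyf_kcoef.
by apply: polyf_det => a b; exact: polyf_vmat.
Qed.

Lemma mpolyf_keq : mpolyf (fun X => keq t (M X)).
Proof.
apply: mpolyf_sum => j; apply: mpolyfZ; last exact: mpolyf_opow.
exact/cpolyf_real/polyf_qpoly.
Qed.

Variables (v x : W).
Hypothesis D0 : forall j (i : 'I_k),
  mderive v x (fun X => opow (M X) j) (rep i) (rep i) = 0.

Let D0_Re j (i : 'I_k) :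
  'D_v (fun X => complex.Re (opow (M X) j (rep i) (rep i))) x = 0.
Proof. by have := D0 j i; rewrite mxE => -[]. Qed.

Let vmat0 i j : 'D_v (fun X => vmat t (M X) i j) x = 0.
Proof.
rewrite -[RHS](D0_Re j i); congr ('D_v _ x).
by apply/funext => X; rewrite mxE.
Qed.

Let vrhs0 i j : 'D_v (fun X => vrhs t (M X) i j) x = 0.
Proof.
rewrite -[RHS](D0_Re k i); congr ('D_v _ x).
by apply/funext => X; rewrite mxE.
Qed.

(** The coefficients depend on the matrix only through the diagonal entries of its odd powers at the
    representatives, which [D0] makes stationary. *)
Lemma derive_qpoly0 (j : 'I_k.+1) : 'D_v (fun X => (qpoly t (M X))`_j) x = 0.
Proof.
rewrite (_ : (fun X => (qpoly t (M X))`_j) = (fun X =>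
  if (insub (j : nat) : option 'I_k) is Some i then - kcoef t (M X) i 0
  else \det (vmat t (M X)))); last first.
  by apply/funext => X; rewrite coef_qpolyE.
case: insubP => [i _ _|_]; last first.
  by rewrite polyf_det_derive0// => a b; exact: polyf_vmat.
rewrite deriveN; last exact/polyf_derivable/polyf_kcoef.
rewrite (_ : (fun X => kcoef t (M X) i 0) =
  (fun X => \sum_l \adj (vmat t (M X)) i l * vrhs t (M X) l 0)); last first.
  by apply/funext => X; rewrite kcoefE.
have padj l : polyf (fun X => \adj (vmat t (M X)) i l).
  by apply: polyf_adj => a b; exact: polyf_vmat.
rewrite polyf_sum_derive; last by move=> l; apply: polyfM => //; exact: polyf_vrhs.
rewrite big1 ?oppr0// => l _; rewrite polyfM_derive//; last exact: polyf_vrhs.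
rewrite vrhs0 polyf_adj_derive0 ?mulr0 ?addr0// => a b; exact: polyf_vmat.
Qed.

Lemma mderive_keq0 : mderive v x (fun X => keq t (M X)) =
  \sum_(j < k.+1) ((qpoly t (M x))`_j)%:C *: mderive v x (fun X => opow (M X) j).
Proof.
rewrite [LHS]mderive_sum; last first.
  by move=> j; apply: mpolyfZ; [exact/cpolyf_real/polyf_qpoly | exact: mpolyf_opow].
apply: eq_bigr => j _.
rewrite mderiveZ; [|exact/cpolyf_real/polyf_qpoly|exact: mpolyf_opow].
by rewrite /cderive/= derive_qpoly0 derive_cst scale0r add0r.
Qed.

End KeqPolynomial.

Section KeqDerivative.
Variables (R : realType) (p q n : nat) (t : {set 'I_n}).
Local Notation C := R[i].
Local Notation W := 'M[R]_(p, q).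
Local Notation k := #|~: t|.

Lemma sum_coef_deriv m (g : {poly R}) (c : R) : (size g <= m)%N ->
  \sum_(j < m) g`_j * c ^+ j *+ j = c * g^`().[c].
Proof.
move=> gm.
rewrite (@horner_coef_wide _ m.+1); last first.
  by rewrite (leq_trans (leq_trans (size_poly _ _) (leq_pred _)))// ltnW.
rewrite mulr_sumr; case: m gm => [|m] gm.
  rewrite big_ord0 big_ord1 coef_deriv nth_default ?(leq_trans gm)//.
  by rewrite mul0rn mul0r mulr0.
rewrite big_ord_recl mulr0n add0r [RHS]big_ord_recr/= [X in _ + X](_ : _ = 0) ?addr0.
  rewrite [RHS]big_ord_recr/= [X in _ + X](_ : _ = 0) ?addr0.
    apply: eq_bigr => j _; rewrite coef_deriv /bump leq0n add1n exprS.
    by rewrite mulrnAl mulrnAr; congr (_ *+ _); ring.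
  by rewrite coef_deriv nth_default ?mul0rn ?mul0r ?mulr0.
by rewrite coef_deriv nth_default ?mul0rn ?mul0r ?mulr0// (leq_trans gm)// leqW.
Qed.

(** With stationary coefficients q_j, the weights j + 1 on V and j on conj(V) regroup into the sum
    of q_j c^(2 j), that is q(c^2), on V and the sum of j q_j c^(2 j), that is c^2 q'(c^2), on V +
    conj(V). *)
Lemma mderive_keq (M : W -> 'M[C]_n) (v x : W) (c : R) (V := mderive v x M) : mpolyf M ->
  V *m M x = c%:C *: V -> M x *m V = c%:C *: V -> cj (M x) = M x ->
  (forall i : 'I_k, V (rep i) (rep i) = 0) ->
  mderive v x (fun X => keq t (M X)) =
  ((qpoly t (M x)).[c ^+ 2])%:C *: V +
  (c ^+ 2 * (qpoly t (M x))^`().[c ^+ 2])%:C *: (V + cj V).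
Proof.
move=> pM VM MV Mr Vrep; have dop j := mderive_opow j pM VM MV Mr.
rewrite mderive_keq0//; last first.
  move=> j i; rewrite dop -/V; move: (V) (Vrep i) => V' V'0.
  by rewrite !mxE V'0 rmorph0 !mulr0 addr0 mulr0.
rewrite (horner_coef_wide _ (size_qpoly_le _ _)).
rewrite -(sum_coef_deriv _ (size_qpoly_le _ _)) !rmorph_sum/= !scaler_suml -big_split/=.
apply: eq_bigr => j _; rewrite dop -/V; set g := (qpoly _ _)`_j.
have -> : (c ^+ j.*2)%:C = ((c ^+ 2) ^+ j)%:C :> C by rewrite -exprM mul2n.
set d := (c ^+ 2) ^+ j.
have -> : (g * d *+ j)%:C = (g * d)%:C * j%:R :> C by rewrite -mulr_natr rmorphM/= rmorph_nat.
rewrite rmorphM/= !scalerA -natr1.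
have comb (K : comNzRingType) (L : lmodType K) (a b e : K) (T U : L) :
    (a * b) *: ((e + 1) *: T + e *: U) = (a * b) *: T + (a * b * e) *: (T + U).
  by rewrite !scalerDr !scalerA addrA -scalerDl; congr (_ *: _ + _); ring.
by rewrite comb.
Qed.

End KeqDerivative.

(** * Local equations of the strata *)

Section Blocks.
Variable n : nat.
Implicit Type t : {set 'I_n}.

(* For [t = degen A] and [a <= b <= n]: [sg A a = sg A b]. *)
Definition blk t (a b : nat) : bool := [forall j : 'I_n, (a <= j < b)%N ==> (j \in t)].

(* Index [(a, b, e)]: for [b < a] the real ([e = false]) or imaginary part of
   the antisymmetry equation at [(a, b)], for [a <= b] that of [keq] at [(a, b)]. *)
Definition eqidx t : {set 'I_n * 'I_n * bool} :=
  [set x : 'I_n * 'I_n * bool | (x.1.2 < x.1.1)%N || blk t x.1.1 x.1.2 &&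
    (if x.2 then blk t x.1.2 n else (x.1.1 != x.1.2) || (x.1.1 \in t))].

End Blocks.

Lemma blk_degen (R : realType) n (A : 'M[R[i]]_n) (a b : nat) : (a <= b)%N -> (b <= n)%N ->
  blk (degen A) a b = (sg A a == sg A b).
Proof.
move=> ab bn; apply/forallP/eqP => [H|E j].
  elim: b ab bn H => [|b IH] ab bn H; first by move: ab; rewrite leqn0 => /eqP ->.
  move: ab; rewrite leq_eqVlt => /orP[/eqP->//|]; rewrite ltnS => ab.
  rewrite (IH ab (ltnW bn)) => [|j].
    by have := H (Ordinal bn); rewrite /= ab ltnS leqnn => /degenP.
  apply/implyP => /andP[aj jb]; have := H j.
  by rewrite aj (leq_trans jb).
apply/implyP => /andP[aj jb]; apply/degenP/le_anti.
by rewrite [X in _ && X]sg_le// andbT (le_trans (sg_le A aj))// E sg_le.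
Qed.

Section LocalEquations.
Variables (R : realType) (n : nat).
Local Notation C := R[i].
Local Notation W := 'M[R]_(n, n + n).
Variables (A P : 'M[C]_n).
Hypotheses (AT : A^T = A) (Pu : P \is unitarymx).
Local Notation s := (fun i : 'I_n => sg A i).
Hypothesis PA : P *m A *m P^T = rdiag s.
Local Notation t := (degen A).
Local Notation k := #|~: t|.

Definition phi (X : W) : 'M[C]_n := P *m cplx X *m P^T.
(** Symmetrizing makes the [keq] equations blind to antisymmetric directions, so their differentials
    decouple from those of the antisymmetry equations. *)
Definition sphi (X : W) : 'M[C]_n := 2^-1 *: (phi X + (phi X)^T).
Definition part (e : bool) (z : C) : R := if e then complex.Im z else complex.Re z.
Definition locEq (x : 'I_n * 'I_n * bool) (X : W) : R :=
  part x.2 (if (x.1.2 < x.1.1)%N then phi X x.1.1 x.1.2 - phi X x.1.2 x.1.1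
            else keq t (sphi X) x.1.1 x.1.2).
Definition locF (X : W) : 'rV[R]_#|eqidx t| := \row_j locEq (enum_val j) X.

Lemma mpolyf_phi : mpolyf phi.
Proof.
apply: mpolyfM; last exact: mpolyf_cst.
by apply: mpolyfM; [exact: mpolyf_cst | exact: mpolyf_cplx].
Qed.

Lemma mderive_phi v x : mderive v x phi = phi v.
Proof.
have pP := @mpolyf_cst R n (n + n) n n P.
have pPT := @mpolyf_cst R n (n + n) n n P^T.
have pc := @mpolyf_cplx R n.
rewrite /phi (mderiveM v x (mpolyfM pP pc) pPT) (mderiveM v x pP pc).
by rewrite !mderive_cst mul0mx add0r mulmx0 addr0 mderive_cplx.
Qed.

Lemma mpolyf_sphi : mpolyf sphi.
Proof.
apply: mpolyfZ; first exact: cpolyf_cst.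
by apply: mpolyfD; [exact: mpolyf_phi | exact/mpolyfT/mpolyf_phi].
Qed.

Lemma mderive_sphi v x : mderive v x sphi = sphi v.
Proof.
have pp := mpolyf_phi; have pT := mpolyfT pp.
rewrite /sphi (mderiveZ v x (cpolyf_cst _ _ _) (mpolyfD pp pT)) cderive_cst scale0r add0r.
by rewrite (mderiveD v x pp pT) mderiveT mderive_phi.
Qed.

Lemma cpolyf_part e (G : W -> C) : cpolyf G -> polyf (fun X => part e (G X)).
Proof. by move=> [? ?]; case: e. Qed.

Lemma part_cderive e (G : W -> C) v x :
  'D_v (fun X => part e (G X)) x = part e (cderive v x G).
Proof. by case: e. Qed.

Lemma cpolyf_locEq (x : 'I_n * 'I_n * bool) :
  cpolyf (fun X => if (x.1.2 < x.1.1)%N then phi X x.1.1 x.1.2 - phi X x.1.2 x.1.1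
            else keq t (sphi X) x.1.1 x.1.2).
Proof.
case: (_ < _)%N; last exact: (mpolyf_keq _ mpolyf_sphi).
apply: cpolyf_ext (cpolyfD (mpolyf_phi _ _) (cpolyfM (cpolyf_cst _ _ (-1)) (mpolyf_phi _ _))).
by move=> X; rewrite mulN1r.
Qed.

Lemma polyf_locEq x : polyf (locEq x).
Proof. exact/cpolyf_part/cpolyf_locEq. Qed.

Lemma derive_locEq x v X : 'D_v (locEq x) X =
  part x.2 (if (x.1.2 < x.1.1)%N then phi v x.1.1 x.1.2 - phi v x.1.2 x.1.1
            else mderive v X (fun Y => keq t (sphi Y)) x.1.1 x.1.2).
Proof.
transitivity (part x.2 (cderive v X (fun X => if (x.1.2 < x.1.1)%N
    then phi X x.1.1 x.1.2 - phi X x.1.2 x.1.1 else keq t (sphi X) x.1.1 x.1.2))).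
  exact: part_cderive.
congr (part _ _); case: (_ < _)%N; last by rewrite mxE.
rewrite -(mderive_phi v X) [in RHS]mxE [X in _ = _ - X]mxE.
have -> : (fun Y => phi Y x.1.1 x.1.2 - phi Y x.1.2 x.1.1) =
    (fun Y => phi Y x.1.1 x.1.2 + (-1) * phi Y x.1.2 x.1.1).
  by apply/funext => Y; rewrite mulN1r.
rewrite (cderiveD v X (mpolyf_phi _ _) (cpolyfM (cpolyf_cst _ _ (-1)) (mpolyf_phi _ _))).
rewrite (cderiveM v X (cpolyf_cst _ _ (-1)) (mpolyf_phi _ _)) cderive_cst mul0r add0r.
by rewrite mulN1r.
Qed.

Lemma phi_surj (V : 'M[C]_n) : exists v, phi v = V.
Proof.
exists (realify (P^t* *m V *m cj P)); rewrite /phi realifyK !mulmxA (unitarymxP Pu) mul1mx.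
by rewrite -mulmxA unitarymxCTj// mulmx1.
Qed.

Lemma phi_base : phi (realify A) = rdiag s.
Proof. by rewrite /phi realifyK. Qed.

Lemma sphi_sym X : (phi X)^T = phi X -> sphi X = phi X.
Proof.
move=> H; rewrite /sphi H; apply/matrixP => i j.
by move: (phi X) => V; rewrite !mxE; field.
Qed.

Lemma sphi_base : sphi (realify A) = rdiag s.
Proof. by rewrite sphi_sym phi_base ?tr_rdiag. Qed.

Definition unitz (e : bool) : C := if e then Complex 0 1 else 1.

Lemma part_unitz e e' (r : R) : part e' (unitz e * r%:C) = r * (e' == e)%:R.
Proof. by case: e; case: e'; rewrite /part /unitz ?ReM ?ImM /=; ring. Qed.

(** Entries of [E_ab + c E_ba], used with [c = -1] and [c = 1]. For [a = b] and [c = 1] the two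
    terms add up to 2, whence the factor [dirN a b 1 a b] in [dir_sym]. *)
Definition dirN (a b : 'I_n) (c : R) (i j : 'I_n) : R :=
  ((i == a) && (j == b))%:R + c * ((i == b) && (j == a))%:R.

Lemma mulr_eqidx (a b a' b' : 'I_n) (e e' : bool) :
  (((a', b', e') == (a, b, e))%:R : R) = ((a' == a) && (b' == b))%:R * (e' == e)%:R.
Proof. by rewrite !xpair_eqE -natrM mulnb. Qed.

Lemma dir_antisym (a b : 'I_n) (e : bool) : (b < a)%N ->
  exists v, forall x, 'D_v (locEq x) (realify A) = 2 * (x == (a, b, e))%:R.
Proof.
move=> ba; pose V : 'M[C]_n := \matrix_(i, j) (unitz e * (dirN a b (-1) i j)%:C).
have VE i j : V i j = unitz e * (dirN a b (-1) i j)%:C by rewrite mxE.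
have [v vV] := phi_surj V; exists v => -[[a' b'] e'].
rewrite derive_locEq /= vV mulr_eqidx mulrA; case: ifPn => [ba'|ba'].
  rewrite !VE -mulrBr -rmorphB part_unitz; congr (_ * _); rewrite /dirN.
  rewrite [(b' == a) && _]andbC [(b' == b) && _]andbC.
  rewrite (_ : (a' == b) && (b' == a) = false); first by rewrite mulr0n; ring.
  apply/negP => /andP[/eqP a'b /eqP b'a]; move: ba'.
  by rewrite a'b b'a ltnNge ltnW.
have -> : mderive v (realify A) (fun Y => keq t (sphi Y)) = 0.
  have sv0 : mderive v (realify A) sphi = 0.
    rewrite mderive_sphi /sphi vV; apply/matrixP => i j; rewrite !mxE /dirN.
    rewrite [(j == a) && _]andbC [(j == b) && _]andbC -mulrDr -rmorphD.
    rewrite (_ : _ + _ = 0) ?rmorph0 ?mulr0//; ring.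
  (* The derivative of [sphi] is 0 in this direction, so any scalar would do; 0 is taken. *)
  rewrite (@mderive_keq R n (n + n) n t sphi v (realify A) 0 mpolyf_sphi).
  - by rewrite sv0 map_mx0 addr0 !scaler0 addr0.
  - by rewrite sv0 mul0mx scaler0.
  - by rewrite sv0 mulmx0 scaler0.
  - by rewrite sphi_base cj_rdiag.
  - by move=> i; rewrite sv0 mxE.
rewrite mxE (_ : (a' == a) && (b' == b) = false) ?mulr0 ?mul0r; first by case: e'.
apply/negP => /andP[/eqP a'a /eqP b'b]; move: ba'.
by rewrite a'a b'b ba.
Qed.

Lemma eqidx_sym (a b : 'I_n) (e : bool) : (a, b, e) \in eqidx t -> (a <= b)%N ->
  [/\ s a = s b, e -> s a = 0 & a = b -> a \in t].
Proof.
rewrite inE /= => + ab; rewrite ltnNge ab/= => /andP[].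
rewrite (blk_degen A ab (ltnW (ltn_ord b))) => /eqP sab.
case: e => [|/orP h].
  rewrite (blk_degen A (ltnW (ltn_ord b)) (leqnn n)) [sg A n]sg_default// => /eqP sb.
  split=> //; first by rewrite sab.
  move=> ->; apply/degenP; rewrite sb; apply/esym/le_anti; rewrite sg_ge0 andbT.
  by rewrite -sb sg_le.
by split=> // E; case: h => //; rewrite E eqxx.
Qed.

Lemma notin_degen_pos (i : 'I_n) : i \notin t -> 0 < s i.
Proof. exact: notin_degen_gt0. Qed.

Lemma dir_sym (a b : 'I_n) (e : bool) : (a, b, e) \in eqidx t -> (a <= b)%N ->
  exists v, exists2 c, c != 0 &
    forall x, 'D_v (locEq x) (realify A) = c * (x == (a, b, e))%:R.
Proof.
move=> abe ab; have [sab s0 abt] := eqidx_sym abe ab.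
pose q := qpoly t (rdiag s); pose c := s a.
(* The factor by which the differential scales [V]. For [e = false], [V] is real and V + conj(V) = 2
   V. For [e = true], [V] is imaginary and V + conj(V) = 0, in agreement with [g] because then
   [c = 0]. *)
pose g := q.[c ^+ 2] + 2 * (c ^+ 2 * q^`().[c ^+ 2]).
have g0 : g != 0.
  have [c0|c0] := eqVneq c 0.
    rewrite /g c0 expr0n/= mul0r mulr0 addr0 qpoly_rdiag0//; first exact: notin_degen_pos.
    exact: sg_inj_notin.
  have cp : 0 < sg A a by rewrite lt_def c0 sg_ge0.
  have [r rt ra] := exists_notin_degen cp.
  have := qpoly_rdiag_root notin_degen_pos (@sg_inj_notin _ _ A) rt.
  by rewrite ra => -[q0 q1]; rewrite /g q0 add0r !mulf_neq0 ?pnatr_eq0.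
pose V : 'M[C]_n := \matrix_(i, j) (unitz e * (dirN a b 1 i j)%:C).
have VE i j : V i j = unitz e * (dirN a b 1 i j)%:C by rewrite mxE.
have [v vV] := phi_surj V; exists v; exists (g * dirN a b 1 a b).
  rewrite mulf_neq0// /dirN !eqxx/= mul1r.
  by case: (_ && _); rewrite ?addr0 ?oner_eq0// -natrD pnatr_eq0.
have VT : V^T = V.
  apply/matrixP => i j; rewrite [LHS]mxE !VE /dirN.
  by rewrite [(j == a) && _]andbC [(j == b) && _]andbC !mul1r addrC.
have sv : mderive v (realify A) sphi = V.
  by rewrite mderive_sphi sphi_sym vV.
have D (x y i j : 'I_n) : s x = c -> s y = c ->
    ((i == x) && (j == y))%:R * s j = c * ((i == x) && (j == y))%:R /\
    s i * ((i == x) && (j == y))%:R = c * ((i == x) && (j == y))%:R.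
  move=> sx sy; case: (eqVneq i x) => [->|_]; last by rewrite mul0r !mulr0.
  by case: (eqVneq j y) => [->|_]; rewrite ?mul0r ?mulr0// mul1r !mulr1 sx sy.
have NZ i j : dirN a b 1 i j * s j = c * dirN a b 1 i j /\
              s i * dirN a b 1 i j = c * dirN a b 1 i j.
  have [h1 h2] := D a b i j erefl (esym sab).
  have [h3 h4] := D b a i j (esym sab) erefl.
  by rewrite /dirN mul1r mulrDl !mulrDr h1 h2 h3 h4.
have VM : V *m rdiag s = c%:C *: V.
  apply/matrixP => i j; rewrite mul_mx_diag !mxE -mulrA -rmorphM (NZ i j).1 rmorphM/=.
  by rewrite mulrCA.
have MV : rdiag s *m V = c%:C *: V.
  apply/matrixP => i j; rewrite mul_diag_mx !mxE mulrCA -rmorphM (NZ i j).2 rmorphM/=.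
  by rewrite mulrCA.
(* A nonzero diagonal entry occurs only for [a = b], and then [a] lies in [t] and represents no
   block. *)
have Vrep (i : 'I_k) : V (rep i) (rep i) = 0.
  have F : (rep i == a) && (rep i == b) = false.
    apply/negP => /andP[/eqP ia /eqP ib]; have := rep_notin i.
    by rewrite ia abt// -ia ib.
  by rewrite VE /dirN F [(rep i == b) && _]andbC F mulr0n mulr0 addr0 rmorph0 mulr0.
have KE : mderive v (realify A) (fun Y => keq t (sphi Y)) =
    \matrix_(i, j) (unitz e * (g * dirN a b 1 i j)%:C).
  rewrite (@mderive_keq R n (n + n) n t sphi v (realify A) c mpolyf_sphi) ?sv ?sphi_base//.
  - rewrite -/q; apply/matrixP => i j; rewrite !mxE -/c /g.
    set u := q.[c ^+ 2]; set h := c ^+ 2 * _; set x := dirN a b 1 i j.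
    have h0 : e -> h = 0 by move=> /s0 c0; rewrite /h /c c0 expr0n mul0r.
    case: (e) h0 => [->//|_]; rewrite /unitz.
      by rewrite rmorph0 mul0r addr0 mulr0 addr0 rmorphM/= mulrCA.
    rewrite !mul1r conjC_real -!rmorphD -!rmorphM -!rmorphD; congr (_%:C); ring.
  - exact: cj_rdiag.
move=> [[a' b'] e'].
rewrite derive_locEq /= vV mulr_eqidx mulrA; case: ifPn => [ba'|ba'].
  rewrite (_ : (a' == a) && (b' == b) = false).
    have -> : V b' a' = V a' b' by rewrite -{1}VT mxE.
    by rewrite subrr !mulr0 mul0r; case: e'.
  apply/negP => /andP[/eqP a'a /eqP b'b]; move: ba'.
  by rewrite a'a b'b ltnNge ab.
rewrite KE mxE part_unitz; congr (_ * _); rewrite -mulrA; congr (_ * _).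
have [/andP[/eqP -> /eqP ->]|N] := boolP ((a' == a) && (b' == b)); first by rewrite mulr1.
rewrite /dirN (negbTE N) mulr0 add0r (_ : _ && _ = false) ?mulr0//.
apply: contraNF N => /andP[/eqP a'b /eqP b'a].
have ba : (b <= a)%N by rewrite leqNgt -a'b -b'a.
have -> : a' = a by rewrite a'b; apply/val_inj/eqP; rewrite eqn_leq ba ab.
have -> : b' = b by rewrite b'a; apply/val_inj/eqP; rewrite eqn_leq ba ab.
by rewrite !eqxx.
Qed.

Lemma locF_surj (w : 'rV[R]_#|eqidx t|) : exists v, 'd locF (realify A) v = w.
Proof.
have pF j : polyf (fun X => locF X 0 j).
  by apply: polyf_ext (polyf_locEq (enum_val j)) => X; rewrite mxE.
have H j : exists v, forall i, 'd locF (realify A) v 0 i = (i == j)%:R.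
  have [v [c c0 vE]] : exists v, exists2 c, c != 0 &
      forall x, 'D_v (locEq x) (realify A) = c * (x == enum_val j)%:R.
    have := enum_valP j; case: (enum_val j) => [[a b] e] abe.
    have [ab|ba] := leqP a b; first exact: dir_sym.
    by have [v vE] := dir_antisym e ba; exists v; exists 2 => //; rewrite pnatr_eq0.
  exists (c^-1 *: v) => i; rewrite linearZ/= mxE row_polyf_diff//.
  have -> : (fun X => locF X 0 i) = locEq (enum_val i) by apply/funext => X; rewrite mxE.
  by rewrite vE mulrA mulVf// mul1r (inj_eq enum_val_inj).
have [v vE] := choice H.
exists (\sum_j w 0 j *: v j); apply/rowP => i; rewrite linear_sum summxE (bigD1 i)//=.
rewrite linearZ/= mxE vE eqxx mulr1 big1 ?addr0// => j ji.
by rewrite linearZ/= mxE vE eq_sym (negbTE ji) mulr0.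
Qed.

Definition stratum (u : {set 'I_n}) : set W :=
  @realify R n @` [set B | B^T = B /\ degen B = u].

Lemma stratumE u X : stratum u X <-> (cplx X)^T = cplx X /\ degen (cplx X) = u.
Proof.
split=> [[B [BT Bu] <-]|[XT Xu]]; first by rewrite realifyK.
by exists (cplx X); [|rewrite cplxK].
Qed.

Lemma sym_phi X : (phi X)^T = phi X <-> (cplx X)^T = cplx X.
Proof.
split=> [H|H]; last by rewrite /phi !trmx_mul trmxK H mulmxA.
rewrite (unitary_congrK Pu (erefl (phi X))); move: (phi X) H => D DT.
by rewrite !trmx_mul DT -!map_trmx trmxK mulmxA.
Qed.

Lemma det_vmat_base : \det (vmat t (rdiag s)) != 0.
Proof. by apply: det_vmat_rdiag; [exact: notin_degen_pos | exact: sg_inj_notin]. Qed.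

Lemma det_vmat_near : \forall X \near realify A, \det (vmat t (sphi X)) != 0.
Proof.
have pd : polyf (fun X => \det (vmat t (sphi X))).
  by apply: polyf_det => i j; exact/polyf_vmat/mpolyf_sphi.
have d0 : \det (vmat t (sphi (realify A))) != 0 by rewrite sphi_base det_vmat_base.
exact: polyf_near_neq0 pd d0.
Qed.

(** For the converse, the retained equations supply the hypotheses of [conj_commute_rigidity], the
    real diagonal equations at the representatives being identities by [keq_rep]. Rigidity gives
    back all of [keq = 0], and [degen_near] the inclusion under which [keq_degen] applies. *)
Lemma locF_near : \forall X \near realify A, stratum t X <-> locF X = 0.
Proof.
have s0 i : 0 <= (s i)%:C by rewrite ler0c sg_ge0.
have [e e0 eP] := conj_commute_rigidity s0.
have eE : (complex.Re e)%:C = e by rewrite RRe_real// gtr0_real.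
have Re_e0 : 0 < complex.Re e by rewrite -ltcR eE.
have h1 := mpolyf_near (realify A) mpolyf_sphi Re_e0.
have FF := nbhs_filter (realify A).
apply: (@filterS3 _ _ FF _ _ _ _ _ h1 det_vmat_near (degen_near AT)) => X Xe dX Xdeg.
rewrite stratumE; split=> [[XT Xt]|FX].
  have pT := (sym_phi X).2 XT.
  have pt : degen (phi X) = t by rewrite /phi degen_congr.
  have sp := sphi_sym pT; rewrite sp in dX.
  have K0 : keq t (sphi X) = 0 by rewrite sp (keq_vanish pT pt dX).
  have anti a b : phi X a b - phi X b a = 0 by rewrite -{1}pT mxE subrr.
  have z0 i j : (0 : 'M[C]_n) i j = 0 by rewrite mxE.
  by apply/rowP => j; rewrite mxE [RHS]mxE /locEq K0 anti z0 if_same; case: (enum_val j).2.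
have eq0 x : x \in eqidx t -> locEq x X = 0.
  move=> xt; have /rowP/(_ (enum_rank_in xt x)) := FX.
  by rewrite !mxE enum_rankK_in.
have pT : (phi X)^T = phi X.
  have H (a b : 'I_n) : (b < a)%N -> phi X a b = phi X b a.
    move=> ba; apply/eqP; rewrite -subr_eq0 eq_complex /=.
    have r0 := eq0 (a, b, false); have i0 := eq0 (a, b, true).
    move: r0 i0; rewrite !inE /= ba /locEq /= ba => -> // -> //.
    by rewrite eqxx.
  apply/matrixP => a b; rewrite mxE.
  by case: (ltngtP a b) => [/H|/H|/val_inj ->].
have XT := (sym_phi X).1 pT; split=> //.
rewrite -(degen_congr Pu XT) -/(phi X).
have sp := sphi_sym pT; have dphi : \det (vmat t (phi X)) != 0 by rewrite -sp.
apply: keq_degen => //; first by rewrite /phi degen_congr// Xdeg.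
have KT : (keq t (phi X))^T = keq t (phi X) by exact: tr_oddp.
have Kab a b : keq t (phi X) a b = keq t (phi X) b a by rewrite -{1}KT mxE.
apply: (eP (phi X) (keq t (phi X))) => //.
- by move=> i j; have := Xe i j; rewrite eE sphi_base sp !mxE mulr_natl.
- exact: mul_oddp_cj.
- have H (a b : 'I_n) : (a <= b)%N -> s a = s b -> complex.Re (keq t (phi X) a b) = 0.
    move=> ab sab; have [/andP[/eqP<- ta]|N] := boolP ((a == b) && (a \notin t)).
      have tk : a \in ~: t by rewrite finset.in_setC.
      by have := keq_rep (phi X) (enum_rank_in tk a); rewrite /rep enum_rankK_in.
    have := eq0 (a, b, false); rewrite inE /= ltnNge ab/=.
    rewrite (blk_degen A ab (ltnW (ltn_ord b))) sab eqxx/= /locEq /= ltnNge ab/=.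
    by rewrite sp; apply; move: N; rewrite negb_and negbK.
  have H' (a b : 'I_n) : s a = s b -> complex.Re (keq t (phi X) a b) = 0.
    by move=> sab; case: (leqP a b) => [/H->//|/ltnW ba]; rewrite Kab H.
  move=> a b /complexI sab; apply/eqP; rewrite eq_complex.
  by move: (H' a b sab); case: (keq _ _ a b) => x y /= ->; rewrite oppr0 !eqxx.
- have H (a b : 'I_n) : (a <= b)%N -> s a = 0 -> s b = 0 -> keq t (phi X) a b = 0.
    move=> ab sa sb.
    have bab : blk t a b by rewrite (blk_degen A ab (ltnW (ltn_ord b))) sa sb.
    have bbn : blk t b n.
      by rewrite (blk_degen A (ltnW (ltn_ord b)) (leqnn n)) sb sg_default.
    have ta : a \in t.
      apply/degenP; rewrite sa; apply/esym/le_anti.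
      by rewrite sg_ge0 andbT -sa sg_le.
    have := eq0 (a, b, true); have := eq0 (a, b, false).
    rewrite ![_ \in eqidx _]inE /= ltnNge ab /= bab bbn ta orbT /locEq /= ltnNge ab/= sp.
    move=> /(_ isT) r0 /(_ isT) i0; apply/eqP; rewrite eq_complex /=.
    by rewrite r0 i0 eqxx.
  move=> a b /complexI sa /complexI sb.
  by case: (leqP a b) => [/H->//|/ltnW ba]; rewrite Kab H.
Qed.

End LocalEquations.

Lemma stratum_submanifold (R : realType) n (u : {set 'I_n}) :
  is_submanifold #|~: eqidx u| (@stratum R n u).
Proof.
exists #|eqidx u|.
  by rewrite addnC cardsC !card_prod !card_ord card_bool -mulnA muln2 addnn.
move=> _ [A [AT <-] <-]; have [P Pu PA] := takagi_sg AT.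
exists (interior [set X | stratum (degen A) X <-> locF A P X = 0]), (locF A P); split.
- exact: open_interior.
- exact: locF_near.
- apply: row_polyf_smooth => j.
  by apply: polyf_ext (polyf_locEq A P (enum_val j)) => X; rewrite mxE.
- exact: locF_surj.
- apply/seteqP; split=> X [].
    by move=> sX UX; split=> //; have /= := interior_subset UX => -[+ _]; apply.
  by move=> UX FX; split=> //; have /= := interior_subset UX => -[_]; apply.
Qed.

(** * Frontier condition *)

Section Frontier.
Variables (R : realType) (n : nat).
Local Notation C := R[i].
Local Notation W := 'M[R]_(n, n + n).
Implicit Types (u v : {set 'I_n}) (A P : 'M[C]_n).

Lemma stratum_closure_sub u v :
  @stratum R n u `&` closure (@stratum R n v) !=set0 -> v \subset u.
Proof.
move=> [_ [[A [AT <-] <-] clA]].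
have [Y [/stratumE[YT <-] YA]] := clA _ (degen_near AT).
exact: YA.
Qed.

(** The number of indices [j >= i] off [v]: from i to i + 1 it drops by 1 if i is off [v] and is
    constant otherwise, so its coincidences are exactly those of [v]. *)
Definition tailc v (i : nat) : R := \sum_(j < n | (i <= j)%N) (j \notin v)%:R.

Lemma tailc_ge0 v i : 0 <= tailc v i.
Proof. by rewrite sumr_ge0. Qed.

Lemma tailc_default v i : (n <= i)%N -> tailc v i = 0.
Proof.
move=> ni; rewrite /tailc big_pred0// => j; apply/negbTE.
by rewrite -ltnNge (leq_trans (ltn_ord j)).
Qed.

Lemma tailcS v (i : 'I_n) : tailc v i = (i \notin v)%:R + tailc v i.+1.
Proof.
rewrite /tailc (bigD1 i)//=; congr (_ + _); apply: eq_bigl => j.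
by rewrite [RHS]ltn_neqAle andbC eq_sym.
Qed.

Lemma tailc_le v (i j : nat) : (i <= j)%N -> tailc v j <= tailc v i.
Proof.
move=> ij; rewrite /tailc [leRHS](bigID (fun l : 'I_n => (j <= l)%N))/=.
rewrite [X in _ <= X + _](eq_bigl (fun l : 'I_n => (j <= l)%N)) ?lerDl ?sumr_ge0// => l.
by rewrite andb_idl// => /(leq_trans ij).
Qed.

(* Raising the singular values by multiples of [e] splits the blocks of equal
   ones exactly as prescribed by [v]. *)
Definition spread A P v (e : R) : 'M[C]_n :=
  P^t* *m rdiag (fun i : 'I_n => sg A i + e * tailc v i) *m cj P.

Lemma tr_unitary_congr P (D : 'M[C]_n) : D^T = D -> (P^t* *m D *m cj P)^T = P^t* *m D *m cj P.
Proof. by move=> DT; rewrite !trmx_mul DT -!map_trmx trmxK mulmxA. Qed.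

Lemma spread_degen A P v (e : R) : P \is unitarymx -> v \subset degen A -> 0 < e ->
  (spread A P v e)^T = spread A P v e /\ degen (spread A P v e) = v.
Proof.
move=> Pu vA e0; set B := spread A P v e.
have BT : B^T = B by apply: tr_unitary_congr; exact: tr_rdiag.
split=> //.
have PB : P *m B *m P^T = rdiag (fun i : 'I_n => sg A i + e * tailc v i).
  rewrite /B /spread !mulmxA (unitarymxP Pu) mul1mx -mulmxA unitarymxCTj// mulmx1//.
have f0 i : 0 <= sg A i + e * tailc v i.
  by rewrite addr_ge0 ?sg_ge0// mulr_ge0 ?tailc_ge0// ltW.
have sB (i : nat) : sg B i = sg A i + e * tailc v i.
  have [ni|ni] := leqP n i; first by rewrite !sg_default// tailc_default// mulr0 addr0.
  apply: (sg_unique Pu _ _ PB (Ordinal ni)) => [j|j l jl]; first exact: f0.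
  by rewrite lerD ?sg_le// ler_wpM2l ?tailc_le// ltW.
apply/setP => i; rewrite inE !sB tailcS.
have [iv|iv] := boolP (i \in v).
  by have /degenP -> := fintype.subsetP vA i iv; rewrite add0r eqxx.
apply/negbTE; rewrite gt_eqF// mulrDr mulr1 addrA ltrD2r.
by rewrite -[ltLHS]addr0 ler_ltD// sg_le.
Qed.

Lemma stratum_sub_closure u v : v \subset u ->
  @stratum R n u `<=` closure (@stratum R n v).
Proof.
move=> vu _ [A [AT Au] <-] B /nbhs_ballP[r /= r0 rB].
have [P Pu PA] := takagi_sg AT.
pose w : W := realify (P^t* *m rdiag (fun i : 'I_n => tailc v i) *m cj P).
have w0 : 0 < 1 + `|w| by rewrite ltr_pwDl.
(* Makes the norm of [e *: w] at most r / 2; the summand 1 covers [w = 0]. *)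
pose e := r / 2 / (1 + `|w|).
have e0 : 0 < e by rewrite !divr_gt0.
have [ST Sv] : (spread A P v e)^T = spread A P v e /\ degen (spread A P v e) = v.
  by apply: spread_degen => //; rewrite Au.
have SE : realify (spread A P v e) = realify A + e *: w.
  apply: (can_inj (@cplxK R n)); rewrite realifyK.
  have E : cplx (realify A + e *: w) = A + e%:C *: cplx w.
    rewrite -[in RHS](realifyK A); move: (realify A) => X.
    apply/matrixP => i j; rewrite !mxE; apply/eqP; rewrite eq_complex /=.
    by apply/andP; split; apply/eqP; ring.
  rewrite E realifyK {2}(unitary_congrK Pu PA) scalemxAl scalemxAr -mulmxDl -mulmxDr.
  rewrite /spread; congr (_ *m _ *m _); apply/matrixP => i j.
  have entryE (M N : 'M[C]_n) (z : C) : (M + z *: N) i j = M i j + z * N i j.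
    by rewrite !mxE.
  rewrite entryE !rdiagE; case: ifP => _.
    by rewrite rmorphD rmorphM.
  by rewrite mulr0 addr0.
exists (realify (spread A P v e)); split; first by exists (spread A P v e).
apply: rB; rewrite SE -ball_normE /= opprD addrA subrr sub0r normrN normrZ.
rewrite gtr0_norm// (_ : e * `|w| = r / 2 * (`|w| / (1 + `|w|))); last by rewrite /e; ring.
have : `|w| / (1 + `|w|) <= 1 by rewrite ler_pdivrMr// mul1r lerDr.
have r20 : 0 < r / 2 by rewrite divr_gt0.
move=> h; apply: (@le_lt_trans _ _ (r / 2)); first by rewrite ler_piMr// ltW.
by rewrite ltr_pdivrMr// ltr_pMr// ltr1n.
Qed.

(** All coincidences hold at the zero matrix, so it can be spread to any pattern. *)
Lemma stratum_nonempty v : @stratum R n v !=set0.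
Proof.
have [B [BT Bv]] : exists B : 'M[C]_n, B^T = B /\ degen B = v.
  exists (spread (0 : 'M[C]_n) 1%:M v 1); apply: spread_degen => //; first exact: unitarymx1.
  apply/fintype.subsetP => i _; apply/degenP.
  have s0 j : sg (0 : 'M[C]_n) j = 0.
    have [nj|nj] := leqP n j; first by rewrite sg_default.
    rewrite (@sg_unique _ _ 1%:M 0 (fun=> 0) _ _ _ _ (Ordinal nj))//.
      exact: unitarymx1.
    by rewrite mulmx0 mul0mx; apply/matrixP => a b; rewrite rdiagE mxE; case: ifP.
  by rewrite !s0.
by exists (realify B); exists B.
Qed.

Lemma strata_has_dim (T : {set {set 'I_n}}) (m : nat) :
  (forall u, u \in T -> (#|~: eqidx u| <= m)%N) ->
  (exists2 u, u \in T & #|~: eqidx u| = m) ->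
  has_real_dim [set A : 'M[C]_n | A^T = A /\ degen A \in T] m.
Proof.
move=> le_m [u0 u0T u0m].
exists #|T|, (fun i => @stratum R n (enum_val i)), (fun i => #|~: eqidx (enum_val i)|).
split; [split| |].
- by move=> i; exact: stratum_nonempty.
- by move=> i; exact: stratum_submanifold.
- apply/trivIsetP => i j _ _ ij; apply/seteqP; split=> // X [/stratumE[_ Xi] /stratumE[_ Xj]].
  by move: ij; rewrite -(inj_eq enum_val_inj) -Xi Xj eqxx.
- apply/seteqP; split=> [X [i _ /stratumE[XT Xi]]|_ [A [AT At] <-]].
    by exists (cplx X); [split=> //; rewrite Xi enum_valP | rewrite cplxK].
  exists (enum_rank_in At (degen A)) => //; rewrite enum_rankK_in//.
  by exists A.
- by move=> i j /stratum_closure_sub; exact: stratum_sub_closure.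
- by move=> i; apply: le_m; exact: enum_valP.
- by exists (enum_rank_in u0T u0); rewrite enum_rankK_in.
Qed.

End Frontier.

(** * Codimension count *)

Section Counting.
Variable n : nat.
Implicit Types (u v : {set 'I_n}).

Lemma blkS u v a b : u \subset v -> blk u a b -> blk v a b.
Proof.
move=> uv /forallP H; apply/forallP => j; apply/implyP => abj.
by apply: (fintype.subsetP uv); apply: (implyP (H j)).
Qed.

Lemma eqidxS u v : u \subset v -> eqidx u \subset eqidx v.
Proof.
move=> uv; apply/fintype.subsetP => -[[a b] e]; rewrite !inE /=.
case/orP => [->//|/andP[/(blkS uv) -> h]]; apply/orP; right => /=.
case: e h => [/(blkS uv)//|/orP[->//|/(fintype.subsetP uv) ->]].
by rewrite orbT.
Qed.

Definition upidx : {set 'I_n * 'I_n * bool} := [set x : 'I_n * 'I_n * bool | (x.1.1 <= x.1.2)%N].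

(** The pairs with a <= b and those with b <= a are equinumerous, cover the square and share the
    diagonal, so twice the number of the former is n^2 + n. *)
Lemma card_upidx : #|upidx| = (n ^ 2 + n)%N.
Proof.
pose L := finset (fun p : 'I_n * 'I_n => p.1 <= p.2)%N.
pose G := finset (fun p : 'I_n * 'I_n => p.2 <= p.1)%N.
have -> : upidx = finset.setX L (finset.setTfor bool).
  by apply/setP => -[p e]; rewrite !inE /= andbT.
rewrite cardsX cardsT card_bool muln2 -addnn.
have GL : #|G| = #|L|.
  pose sw (p : 'I_n * 'I_n) := (p.2, p.1).
  have swK : involutive sw by case.
  have -> : G = sw @: L; last exact: card_imset (inv_inj swK).
  apply/setP => p; rewrite !inE; apply/idP/imsetP => [Gp|[q Lq ->]].
    by exists (sw p); rewrite ?swK// inE.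
  by rewrite inE in Lq.
have DI : L :&: G = (fun i : 'I_n => (i, i)) @: finset.setTfor 'I_n.
  apply/setP => -[a b]; rewrite !inE /= -eqn_leq; apply/eqP/imsetP => [/val_inj ->|[i _ [-> ->]]//].
  by exists b; rewrite ?inE.
rewrite -[X in (_ + X)%N]GL -cardsUI DI card_imset; last by move=> i j [].
rewrite cardsT card_ord (_ : L :|: G = finset.setTfor _) ?cardsT ?card_prod ?card_ord//.
by apply/setP => -[a b]; rewrite !inE /= leq_total.
Qed.

Lemma blk_set1 (l : 'I_n) (a b : nat) : (a < b)%N -> (b <= n)%N -> blk [set l] a b ->
  a = l /\ b = l.+1.
Proof.
move=> ab bn /forallP H.
have an : (a < n)%N by exact: leq_trans bn.
have al : a = l.
  have := H (Ordinal an); rewrite /= leqnn ab inE => /eqP <-//.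
split=> //; apply/eqP; rewrite eqn_leq -{2}al ab andbT leqNgt; apply/negP => lb.
have ln : (l.+1 < n)%N by exact: leq_trans bn.
have := H (Ordinal ln); rewrite /= al ltnW// lb inE => /eqP /(congr1 val)/= /eqP.
by rewrite -[X in _ == X]addn0 -addn1 eqn_add2l.
Qed.

Lemma blkxx u a : blk u a a.
Proof. by apply/forallP => j; rewrite ltnNge; case: leqP. Qed.

Lemma blk_step (l : 'I_n) : blk [set l] l l.+1.
Proof.
by apply/forallP => j; rewrite inE ltnS -eqn_leq; apply/implyP => /eqP E; apply/eqP/val_inj.
Qed.

(** A coincidence of two positive values costs the real parts at (l, l) and (l, l + 1). A zero
    value, with l the last index, costs the real and imaginary parts at (l, l). *)
Lemma upidx_eqidx1 (l : 'I_n) : #|upidx :&: eqidx [set l]| = 2%N.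
Proof.
have [ln|ln] := ltnP l.+1 n.
  have -> : upidx :&: eqidx [set l] = [set (l, l, false); (l, Ordinal ln, false)]%SET.
    apply/setP => -[[a b] e]; rewrite !inE /= !xpair_eqE; apply/idP/idP.
      case/andP => ab; rewrite ltnNge ab /= => /andP[].
      move: ab; rewrite leq_eqVlt => /orP[/eqP/val_inj <- _|ab].
        case: e => [/(blk_set1 (ltn_ord a) (leqnn n))[_ nl]|]; last by rewrite eqxx /= => ->.
        by exfalso; have := ln; rewrite -nl ltnn.
      move=> /(blk_set1 ab (ltnW (ltn_ord b)))[al bl].
      have -> : a = l by exact: val_inj.
      case: e => [/(blk_set1 (ltn_ord b) (leqnn n))[_ nl]|_].
        by exfalso; have := ln; rewrite -nl ltnn.
      by rewrite -!val_eqE /= bl !eqxx orbT.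
    case/orP => /andP[/andP[/eqP-> /eqP->] /eqP->] /=.
      by rewrite leqnn blkxx !eqxx !orbT.
    by rewrite leqnSn ltnNge leqnSn /= blk_step -val_eqE /= neq_ltn leqnn.
  have lS : (l == Ordinal ln) = false.
    by apply/negbTE; rewrite -val_eqE /= neq_ltn leqnn.
  by rewrite cards2 !xpair_eqE lS andbF.
have ln' : l.+1 = n by apply/eqP; rewrite eqn_leq ln ltn_ord.
have -> : upidx :&: eqidx [set l] = [set (l, l, false); (l, l, true)]%SET.
  apply/setP => -[[a b] e]; rewrite !inE /= !xpair_eqE; apply/idP/idP.
    case/andP => ab; rewrite ltnNge ab /= => /andP[].
    move: ab; rewrite leq_eqVlt => /orP[/eqP/val_inj <- _|ab]; last first.
      move=> /(blk_set1 ab (ltnW (ltn_ord b)))[_ bl].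
      by have := ltn_ord b; rewrite bl ln' ltnn.
    case: e => [/(blk_set1 (ltn_ord a) (leqnn n))[al _]|]; last by rewrite eqxx /= => ->.
    by rewrite -val_eqE /= al eqxx.
  case/orP => /andP[/andP[/eqP-> /eqP->] /eqP->] /=; rewrite leqnn ltnn /= blkxx.
    by rewrite !eqxx ?orbT.
  by have := blk_step l; rewrite ln'.
by rewrite cards2 !xpair_eqE eqxx.
Qed.

(** All antisymmetry indices belong to [eqidx], so its complement lies in [upidx], whose size is the
    real dimension of the symmetric matrices. *)
Lemma card_eqidxC1 (l : 'I_n) : #|~: eqidx [set l]| = (n ^ 2 + n - 2)%N.
Proof.
have := cardsID (eqidx [set l]) upidx; rewrite card_upidx upidx_eqidx1 => <-.
rewrite addKn; apply: eq_card => -[[a b] e]; rewrite !inE /=.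
by rewrite (leqNgt a b); case: (b < a)%N; rewrite /= ?andbT.
Qed.

Lemma card_eqidxC_le (l : 'I_n) u : l \in u -> (#|~: eqidx u| <= n ^ 2 + n - 2)%N.
Proof.
by move=> lu; rewrite -(card_eqidxC1 l) subset_leq_card// finset.setCS eqidxS// finset.sub1set.
Qed.

End Counting.

Theorem theorem2p1 (R : realType) (n : nat) (hn : (1 <= n)%N) :
  ((2 <= n)%N ->
     has_real_codim_sym (@equal_singular_values R n) 2 /\
     has_real_dim (@equal_singular_values R n) (n ^ 2 + n - 2)%N) /\
  (has_real_codim_sym (@zero_singular_value R n) 2 /\
   has_real_dim (@zero_singular_value R n) (n ^ 2 + n - 2)%N).
Proof.
have codim (S : set 'M[R[i]]_n) : S `<=` @symmetric_mxs R n ->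
    has_real_dim S (n ^ 2 + n - 2)%N ->
    has_real_codim_sym S 2 /\ has_real_dim S (n ^ 2 + n - 2)%N.
  move=> Ssym Sdim; split=> //; split=> //; exists (n ^ 2 + n - 2)%N => //.
  by rewrite subnK// (@leq_trans (1 ^ 2 + 1))// leq_add// leq_exp2r.
split=> [n2|]; apply: codim; try by move=> A [].
(* The last index is excluded, since its coincidence with the value 0 past the end means a zero
   singular value. [sigma] counts from 1 and [degen] from 0, hence the shifts below. *)
- pose T := [set u : {set 'I_n} | [exists i in u, (i.+1 < n)%N]]%SET.
  have -> : @equal_singular_values R n = [set A | A^T = A /\ degen A \in T].
    apply/seteqP; split=> A [AT] /=.
      move=> [j /andP[j0 jn] E]; split=> //; rewrite inE.
      have jn' : (j.-1 < n)%N by lia.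
      apply/existsP; exists (Ordinal jn'); rewrite /= prednK//; apply/andP; split; last by lia.
      by apply/degenP; rewrite /= prednK.
    rewrite inE => /existsP[i /andP[/degenP E iln]]; split=> //.
    by exists i.+1 => //; lia.
  apply: strata_has_dim => [u|].
    by rewrite inE => /existsP[i /andP[iu _]]; exact: card_eqidxC_le iu.
  exists [set Ordinal hn]%SET; last exact: card_eqidxC1.
  by rewrite inE; apply/existsP; exists (Ordinal hn); rewrite inE eqxx.
- have nn : (n.-1 < n)%N by lia.
  pose T := [set u : {set 'I_n} | Ordinal nn \in u]%SET.
  have -> : @zero_singular_value R n = [set A | A^T = A /\ degen A \in T].
    have E (A : 'M[R[i]]_n) : (Ordinal nn \in degen A) = (sigma A n == 0).
      by rewrite inE /= prednK// (sg_default A (leqnn n)).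
    apply/seteqP; split=> A [AT] /=.
      by move=> /eqP An; split=> //; rewrite inE E.
    by rewrite inE E => /eqP.
  apply: strata_has_dim => [u|]; first by rewrite inE => /card_eqidxC_le.
  by exists [set Ordinal nn]%SET; [rewrite !inE | exact: card_eqidxC1].
Qed.
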